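(* Let $\mathcal I=(I_n)_{n\ge 1}$ be an $\mathrm{Inc}$-invariant chain of eventually nonzero edge ideals and let $r=\mathrm{ind}(\mathcal I)$ be its stability index. Let $G_n$ be the graph on the vertex set $[n]=\{1,\ldots,n\}$ corresponding to $I_n$. Write $E(G_r)=\{\{i_1,j_1\},\ldots,\{i_s,j_s\}\}$ where $1\le i_t<j_t\le r$, $i_1\le i_2\le\cdots\le i_s$, and $j_t<j_{t+1}$ whenever $i_t=i_{t+1}$. Put $q=\max\{1\le t\le s: i_t=i_1\}$. Then the following statements are equivalent: (1) $\operatorname{reg} I_n=2$ for all $n\gg 0$; (2) either $j_q=\max\{j_1,\ldots,j_s\}$, or it holds that $\min\{j_t-i_t: t=1,\ldots,s\}=1$ and $\operatorname{indmatch}(G_{3r})=1$.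
   Context: Let $\Bbbk$ be a field, $R_n=\Bbbk[x_1,\ldots,x_n]$ the standard graded polynomial ring, $R=\bigcup_{n\ge 1}R_n$, and $\mathbb N$ the set of positive integers. $\mathrm{Inc}$ is the monoid of strictly increasing functions $\pi:\mathbb N\to\mathbb N$ under composition, acting on $R$ by $\Bbbk$-algebra endomorphisms via $\pi(x_i)=x_{\pi(i)}$. A family $\mathcal I=(I_n)_{n\ge 1}$ of ideals $I_n\subseteq R_n$ is an $\mathrm{Inc}$-invariant chain if $\pi(I_m)\subseteq I_n$ for all $1\le m<n$ and all $\pi\in\mathrm{Inc}$ with $\pi(m)\le n$. For $m\le n$ put $\mathrm{Inc}_{m,n}=\{\pi\in\mathrm{Inc}\mid \pi(m)\le n\}$. The stability index $\mathrm{ind}(\mathcal I)$ is the smallest $r\ge 1$ such that for all $n\ge r$, $I_n$ is the ideal of $R_n$ generated by $\mathrm{Inc}_{r,n}(I_r)=\{\pi(f):\pi\in \mathrm{Inc}_{r,n}, f\in I_r\}$ (such an $r$ always exists). An edge ideal is an ideal of $R_n$ generated by squarefree quadratic monomials; the corresponding graph $G_n$ on $[n]$ has $\{i,j\}$ as an edge ($i\ne j$) iff $x_ix_j\in I_n$. A chain of eventually nonzero edge ideals is one in which each $I_n$ is an edge ideal and $I_n\neq 0$ for all $n\gg 0$. $\operatorname{reg}$ denotes Castelnuovo–Mumford regularity. $\operatorname{indmatch}(G)$ is the induced matching number: the maximal $g$ such that $G$ has an induced subgraph isomorphic to $gK_2$ ($g$ pairwise disjoint edges, with no other edges among their vertices).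 *)

(* Defs.v *)
From HB Require Import structures.
From mathcomp Require Import all_boot all_order all_algebra.
From mathcomp Require Import mpoly.

Set Implicit Arguments.
Unset Strict Implicit.
Unset Printing Implicit Defensive.

Import GRing.Theory.
Local Open Scope ring_scope.

(** Conventions.  The variables of [R_n] and the vertices of [G_n] are indexed
    by ['I_n], i.e. from 0, so [x_i] (i >= 1) is ['X_(i - 1)], and a map
    [pi] of [Inc] is represented by [fun i => pi (i + 1) - 1].  Ideals of [R_n]
    are [Prop]-valued predicates.  Families are indexed by all of [nat], but
    their term of index 0 is never constrained nor used. *)

Definition is_ideal (k : fieldType) (n : nat) (I : {mpoly k[n]} -> Prop) : Prop :=
  [/\ I 0,
      forall f g, I f -> I g -> I (f + g)
    & forall f g, I g -> I (f * g)].

Definition ideal_gen (k : fieldType) (n : nat) (B : {mpoly k[n]} -> Prop)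
    (f : {mpoly k[n]}) : Prop :=
  forall J : {mpoly k[n]} -> Prop,
    is_ideal J -> (forall g, B g -> J g) -> J f.

Definition Inc (pi : nat -> nat) : Prop := {homo pi : i j / (i < j)%N}.

(** [Inc_to m n pi]: [pi] belongs to [Inc_{m,n}].  With indices starting at 0,
    the condition [pi(m) <= n] reads [pi (m - 1) < n]; used for [1 <= m]. *)
Definition Inc_to (m n : nat) (pi : nat -> nat) : Prop :=
  Inc pi /\ (pi m.-1 < n)%N.

(** The action of [pi] as a map from [R_m] to [R_n].  The default value 0 is
    never taken when [Inc_to m n pi] holds. *)
Definition inc_act (k : fieldType) (m n : nat) (pi : nat -> nat)
    (f : {mpoly k[m]}) : {mpoly k[n]} :=
  f \mPo [tuple oapp (fun j : 'I_n => 'X_j) 0 (insub (pi i)) | i < m].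

Definition Inc_invariant_chain (k : fieldType)
    (I : forall n : nat, {mpoly k[n]} -> Prop) : Prop :=
  (forall n, (1 <= n)%N -> is_ideal (I n)) /\
  (forall m n pi (f : {mpoly k[m]}), (1 <= m)%N -> (m < n)%N ->
     Inc_to m n pi -> I m f -> I n (inc_act n pi f)).

Definition Inc_image (k : fieldType) (m n : nat) (I : {mpoly k[m]} -> Prop)
    (g : {mpoly k[n]}) : Prop :=
  exists pi f, [/\ Inc_to m n pi, I f & g = inc_act n pi f].

Definition stabilizes_at (k : fieldType)
    (I : forall n : nat, {mpoly k[n]} -> Prop) (r : nat) : Prop :=
  forall n, (r <= n)%N -> forall f, I n f <-> ideal_gen (Inc_image (I r)) f.

Definition is_stability_index (k : fieldType)
    (I : forall n : nat, {mpoly k[n]} -> Prop) (r : nat) : Prop :=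
  [/\ (1 <= r)%N, stabilizes_at I r
    & forall r', (1 <= r')%N -> stabilizes_at I r' -> (r <= r')%N].

Definition is_edge_ideal (k : fieldType) (n : nat)
    (I : {mpoly k[n]} -> Prop) : Prop :=
  exists B : {mpoly k[n]} -> Prop,
    (forall f, B f -> exists i j : 'I_n, i != j /\ f = 'X_i * 'X_j) /\
    (forall f, I f <-> ideal_gen B f).

Definition eventually_nonzero (k : fieldType)
    (I : forall n : nat, {mpoly k[n]} -> Prop) : Prop :=
  exists N, forall n, (N <= n)%N -> exists f, I n f /\ f <> 0.

Definition edge_graph (k : fieldType) (n : nat) (I : {mpoly k[n]} -> Prop)
    (i j : 'I_n) : Prop :=
  i != j /\ I ('X_i * 'X_j).

(** The edges of [G] are the [{i t, j t}] with [t < s], without repetition and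
    in lexicographic order; [i t] and [j t] are irrelevant for [s <= t]. *)
Definition lex_edge_enum (n : nat) (G : 'I_n -> 'I_n -> Prop) (s : nat)
    (i j : nat -> nat) : Prop :=
  [/\ forall t, (t < s)%N -> (i t < j t < n)%N,
      forall a b : 'I_n, (a < b)%N ->
        (G a b <-> exists t, [/\ (t < s)%N, i t = a & j t = b]),
      forall t, (t.+1 < s)%N -> (i t <= i t.+1)%N
    & forall t, (t.+1 < s)%N -> i t = i t.+1 -> (j t < j t.+1)%N].

Definition gK2 (g : nat) : rel ('I_g * bool) :=
  fun x y => (x.1 == y.1) && (x.2 != y.2).

Definition has_induced_gK2 (n : nat) (G : 'I_n -> 'I_n -> Prop) (g : nat) : Prop :=
  exists phi : 'I_g * bool -> 'I_n,
    injective phi /\ forall x y, G (phi x) (phi y) <-> gK2 x y.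

Definition is_indmatch (n : nat) (G : 'I_n -> 'I_n -> Prop) (g : nat) : Prop :=
  has_induced_gK2 G g /\ forall h, has_induced_gK2 G h -> (h <= g)%N.

(** A sequence of maps ... -> F_1 -> F_0 -> R_n of free modules
    F_p = \bigoplus_l R_n(- fshift p l), elements of F_p being row vectors on
    which the matrices act on the right. *)
Record free_seq (k : fieldType) (n : nat) := FreeSeq {
  frank : nat -> nat;
  fshift : forall p, 'I_(frank p) -> nat;
  fdiff : forall p, 'M[{mpoly k[n]}]_(frank p.+1, frank p);
  faug : 'cV[{mpoly k[n]}]_(frank 0%N)
}.

(** The maps are homogeneous of degree 0.  An entry of [fdiff] whose source
    generator has degree smaller than its target generator has to vanish. *)
Definition fs_graded (k : fieldType) (n : nat) (F : free_seq k n) : Prop :=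
  (forall p l m, fdiff F p l m = 0 \/
     exists e, fshift l = (fshift m + e)%N /\ fdiff F p l m \is e.-homog) /\
  (forall l, faug F l ord0 \is (fshift l).-homog).

(** F_p -> ... -> F_0 -> I -> 0 is exact. *)
Definition fs_resolves (k : fieldType) (n : nat) (F : free_seq k n)
    (I : {mpoly k[n]} -> Prop) : Prop :=
  [/\ forall f, I f <-> exists u : 'rV_(frank F 0), f = (u *m faug F) ord0 ord0,
      forall u : 'rV_(frank F 0),
        u *m faug F = 0 <-> exists v, u = v *m fdiff F 0
    & forall p (u : 'rV_(frank F p.+1)),
        u *m fdiff F p = 0 <-> exists v, u = v *m fdiff F p.+1].

(** The image of F_{p+1} lies in (x_1, ..., x_n) F_p, i.e. the entries of the
    differentials have no constant term. *)
Definition fs_minimal (k : fieldType) (n : nat) (F : free_seq k n) : Prop :=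
  forall p l m, (fdiff F p l m)@_0%MM = 0.

(** reg I = max {j - p | R_n(-j) is a summand of F_p}, where F is a minimal
    graded free resolution of the ideal I (not of R_n / I).  The zero ideal
    has no regularity in this sense. *)
Definition has_reg (k : fieldType) (n : nat) (I : {mpoly k[n]} -> Prop)
    (d : nat) : Prop :=
  exists F : free_seq k n,
    [/\ fs_graded F, fs_resolves F I, fs_minimal F,
        forall p (l : 'I_(frank F p)), (fshift l <= p + d)%N
      & exists p (l : 'I_(frank F p)), fshift l = (p + d)%N].

(* Main.v *)
(** The ideal [I_n] is generated by the edges [{u < v}] of an explicit graph:
    for some edge [{i_t < j_t}] of [G_r] one has [i_t <= u],
    [j_t - i_t <= v - u] and [v <= n - r + j_t].  The regularity of [I_n] is 2
    iff [R_n / I_n] has a resolution that is linear after its first step.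

    Such a resolution exists when the edges can be ordered so that all
    successive colon ideals are generated by variables: adding a generator then
    amounts to a mapping cone.  Under either condition of (2) an explicit order
    has this property: longest edges first, or an order adapted to the
    decomposition of the vertices into a middle part, which is a clique, and
    two ends.

    Conversely, a linear resolution forces the first cohomology of the clique
    complex of the complement of [G_n], on any set of vertices, to vanish: a
    1-cocycle is turned into a Koszul cycle modulo [I_n], and a diagram chase
    against the linear resolution shows that it is a boundary.  If no edge joins
    consecutive vertices and [j_q] is not maximal, the indicator function of the
    long non-edges is a nontrivial cocycle.  If some edge joins
    consecutive vertices, an induced [2K_2] in [G_{3r}] has one edge at each end,
    hence persists in [G_n], where it is an obstruction of the same kind. *)

From HB Require Import structures.
Require Import Defs.
From Stdlib Require Import ClassicalEpsilon.
From mathcomp Require Import all_boot all_order all_algebra.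
From mathcomp Require Import mpoly zify ring.

Set Implicit Arguments.
Unset Strict Implicit.
Unset Printing Implicit Defensive.

Import GRing.Theory.
Local Open Scope ring_scope.

(** * Mapping cones of linear resolutions *)

Section GradedMatrices.
Variables (k : fieldType) (n : nat).
Local Notation R := {mpoly k[n]}.

(** Multiplication by [q] raises degrees by exactly [e], so only the degree [d] component of [p]
    contributes. *)
Lemma pihomog_mulr d e (p q : R) : q \is e.-homog ->
  pihomog mdeg (d + e) (p * q) = pihomog mdeg d p * q.
Proof.
move=> hq.
have [N hN] : exists N, (msize p <= N)%N /\ (d < N)%N.
  by exists (maxn (msize p) d.+1); rewrite leq_maxl leq_maxr.
case: hN => hN hd.
rewrite [in LHS](pihomog_partitionE hN) mulr_suml raddf_sum /=.
rewrite (bigD1 (Ordinal hd)) //= big1 ?addr0.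
  by apply: pihomog_dE; apply: dhomogM hq; apply: pihomogP.
move=> i hi; apply: (@pihomog_ne0 _ _ _ (i + e)%N).
  by rewrite eqn_add2r; apply: contra hi => /eqP hi; apply/eqP/val_inj.
by apply: dhomogM hq; apply: pihomogP.
Qed.

Definition homog_mx e (a b : nat) (M : 'M[R]_(a, b)) : Prop :=
  forall i j, M i j \is e.-homog.

Lemma homog_mx_mul d e a b c (M : 'M[R]_(a, b)) (N : 'M[R]_(b, c)) :
  homog_mx d M -> homog_mx e N -> homog_mx (d + e) (M *m N).
Proof.
move=> hM hN i j; rewrite mxE; apply: rpred_sum => l _.
by apply: dhomogM; [apply: hM | apply: hN].
Qed.

(** The hypothesis on rows gives a lift without control of degrees. Truncating its entries to their
    degree [d] components preserves the product, because [A] and [M] are homogeneous. *)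
Lemma homog_mx_lift d e a b c (A : 'M[R]_(a, b)) (M : 'M[R]_(c, b)) :
    homog_mx e A -> homog_mx (d + e) M ->
    (forall i, exists v, row i M = v *m A) ->
  exists2 X : 'M_(c, a), homog_mx d X & X *m A = M.
Proof.
move=> hA hM /fin_all_exists [v hv].
exists (\matrix_(i, l) pihomog mdeg d (v i ord0 l)).
  by move=> i l; rewrite mxE; apply: pihomogP.
apply/matrixP=> i j; rewrite mxE.
rewrite -[RHS](pihomog_dE (hM i j)).
have -> : M i j = (v i *m A) ord0 j by rewrite -hv mxE.
rewrite mxE raddf_sum; apply: eq_bigr => l _.
by rewrite mxE /= pihomog_mulr.
Qed.

End GradedMatrices.

Section MappingCone.
Variables (k : fieldType) (n : nat).
Local Notation R := {mpoly k[n]}.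
Implicit Types (F A C : free_seq k n) (I J : R -> Prop).

(* [full_rank] and [full_diff] prepend [R_n] to a resolution of an ideal [I],
   giving a resolution of [R_n / I]. *)
Definition full_rank F p := if p is p'.+1 then frank F p' else 1%N.

Definition full_diff F p : 'M[R]_(full_rank F p.+1, full_rank F p) :=
  if p is p'.+1 then fdiff F p' else faug F.

(* [R_n / I] has a resolution with generators in degree [t + p - 1] at the
   [p]-th place, [p >= 1]; minimality is then automatic. *)
Definition linear_res t I : Prop :=
  exists F : free_seq k n,
    [/\ fs_resolves F I, homog_mx t (faug F)
      & forall p, homog_mx 1 (fdiff F p)].

Lemma linear_res_iff t I J : (forall f, I f <-> J f) ->
  linear_res t I -> linear_res t J.
Proof.
move=> h [F [[h1 h2 h3] hF1 hF2]]; exists F; split=> //; split=> // f.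
by rewrite -h.
Qed.

Lemma full_diff_exact F I : fs_resolves F I ->
  forall p (u : 'rV_(full_rank F p.+1)),
    u *m full_diff F p = 0 <-> exists v, u = v *m full_diff F p.+1.
Proof. by move=> [_ h0 h1] [|p] u; [apply: h0 | apply: h1]. Qed.

Section Cone.
Variables (A C : free_seq k n) (I J : R -> Prop) (f : R) (t : nat).
Hypotheses (resA : fs_resolves A I) (resC : fs_resolves C J).
Hypotheses (homA0 : homog_mx t (faug A)).
Hypotheses (homA : forall p, homog_mx 1 (fdiff A p)).
Hypotheses (homC0 : homog_mx 1 (faug C)).
Hypotheses (homC : forall p, homog_mx 1 (fdiff C p)).
Hypotheses (hf : f \is t.-homog) (colon : forall g, J g <-> I (g * f)).

(** The comparison map lifting multiplication by [f]. Each component depends on the choice of the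
    previous one, hence [epsilon]; [cone_map_spec] shows that a valid choice always exists. *)
Fixpoint cone_map p : 'M[R]_(full_rank C p, full_rank A p) :=
  if p is p'.+1 return 'M[R]_(full_rank C p, full_rank A p)
  then epsilon (inhabits 0) (fun X => homog_mx 1 X /\
         X *m full_diff A p' = full_diff C p' *m cone_map p')
  else f%:M.

Lemma homC_full p : homog_mx 1 (full_diff C p).
Proof. by case: p => [|p]; [apply: homC0 | apply: homC]. Qed.

(** Comparison theorem for resolutions, with degrees. The entries of [faug C] have degree 1, while
    [f] and the entries of [faug A] have degree [t], so every component after the first is
    linear. *)
Lemma cone_map_spec p : homog_mx (if p is 0%N then t else 1%N) (cone_map p) /\
  homog_mx 1 (cone_map p.+1) /\
  cone_map p.+1 *m full_diff A p = full_diff C p *m cone_map p.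
Proof.
elim: p => [|p [_ [IH1 IH2]]] /=.
  split; first by move=> i j; rewrite !ord1 mxE eqxx mulr1n.
  set Q := fun X : 'M__ => _.
  suff [X hX] : exists X, Q X by exact: (epsilon_spec (inhabits 0) Q (ex_intro Q X hX)).
  rewrite /Q; case: (@homog_mx_lift k n 1 t _ _ _ (faug A) (faug C *m f%:M)) => //.
  - apply: homog_mx_mul => // i j.
    by rewrite !ord1 mxE eqxx mulr1n.
  - move=> i; case: resA => hI _ _; case: resC => hJ _ _.
    (* A generator of [J] times [f] lies in [I], hence in the image of [faug A]. *)
    have /colon /hI [u hu] : J (faug C i ord0).
      by apply/hJ; exists (delta_mx 0 i); rewrite -rowE mxE.
    exists u; apply/matrixP => a b; rewrite !ord1 mxE -hu mul_mx_scalar mxE mulrC.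
    by [].
  by move=> X hX1 hX2; exists X.
split; first exact: IH1.
set Q := fun X : 'M__ => _.
suff [X hX] : exists X, Q X by exact: (epsilon_spec (inhabits 0) Q (ex_intro Q X hX)).
rewrite /Q.
case: (@homog_mx_lift k n 1 1 _ _ _ (full_diff A p.+1)
        (full_diff C p.+1 *m cone_map p.+1)) => //.
- exact: homA.
- by apply: homog_mx_mul; [exact: (@homC_full p.+1) | exact: IH1].
- move=> i; apply/(full_diff_exact resA).
  rewrite row_mul -mulmxA IH2 mulmxA.
  suff -> : row i (full_diff C p.+1) *m full_diff C p = 0 by rewrite mul0mx.
  by apply/(full_diff_exact resC); exists (delta_mx 0 i); rewrite -rowE.
- by move=> X hX1 hX2; exists X.
Qed.

Lemma cone_map_comm p :
  cone_map p.+1 *m full_diff A p = full_diff C p *m cone_map p.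
Proof. by case: (cone_map_spec p) => _ []. Qed.

Lemma cone_map_homog p : homog_mx 1 (cone_map p.+1).
Proof. by case: (cone_map_spec p) => _ []. Qed.

(** The sign of the lower right block makes consecutive maps compose to zero. Degrees are tracked by
    [homog_mx] on the matrices, not by the shifts. *)
Definition cone : free_seq k n :=
  @FreeSeq k n (fun p => frank A p + full_rank C p)%N (fun _ _ => 0%N)
    (fun p => block_mx (fdiff A p) 0 (cone_map p.+1) (- full_diff C p))
    (col_mx (faug A) (cone_map 0)).

(** For a cycle [(a, b)], the part [b] is a cycle of [C]; writing it as the image of [w] and
    correcting [a] by the comparison map gives a cycle of [A]. At the bottom, [colon] turns [b * f]
    in [I] into [b] in [J]. *)
Lemma cone_resolves :
  fs_resolves cone (fun g => exists a b, I a /\ g = a + b * f).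
Proof.
have hA := full_diff_exact resA; have hC := full_diff_exact resC.
case: resA => hI _ _; case: resC => hJ _ _.
split => /=.
- move=> g; split.
    move=> [a [b [/hI [u ->] ->]]].
    exists (row_mx u b%:M); rewrite mul_row_col [RHS]mxE mul_mx_scalar.
    by congr (_ + _); rewrite !mxE eqxx mulr1n mulrC.
  move=> [u ->]; rewrite -[u]hsubmxK mul_row_col mxE.
  exists ((lsubmx u *m faug A) ord0 ord0), (rsubmx u ord0 ord0); split.
    by apply/hI; exists (lsubmx u).
  by congr (_ + _); rewrite mul_mx_scalar mxE mulrC.
- move=> u; rewrite -[u]hsubmxK mul_row_col; split; last first.
    move=> [v]; rewrite -[v]hsubmxK mul_row_block mulmx0 add0r.
    case/eq_row_mx => -> ->.
    rewrite mulmxDl -!mulmxA (cone_map_comm 0) mulNmx !mulmxN !mulmxA.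
    rewrite addrK -mulmxA.
    have -> : fdiff A 0 *m faug A = 0; last by rewrite mulmx0.
    apply/row_matrixP => l; rewrite row_mul row0.
    by apply/(hA 0); exists (delta_mx 0 l); rewrite -rowE.
  set a := lsubmx u; set b := rsubmx u => h.
  have /hJ [w hw] : J (b ord0 ord0).
    apply/colon/hI; exists (- a); rewrite mulNmx.
    rewrite (_ : a *m faug A = - (b *m cone_map 0)); last by apply/eqP; rewrite -addr_eq0 h.
    by rewrite opprK mul_mx_scalar [RHS]mxE mulrC.
  have {}hw : b = w *m faug C by apply/matrixP => x y; rewrite !ord1.
  have /(hA 0) [x hx] : (a + w *m cone_map 1) *m faug A = 0.
    by rewrite mulmxDl -[w *m _ *m _]mulmxA (cone_map_comm 0) mulmxA -hw.
  exists (row_mx x (- w)); rewrite mul_row_block mulmx0 add0r -hx.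
  by rewrite mulNmx addrK mulNmx mulmxN opprK -hw.
- move=> p u; rewrite -[u]hsubmxK mul_row_block mulmx0 add0r mulmxN.
  set a := lsubmx u; set b := rsubmx u; split; last first.
    move=> [v]; rewrite -[v]hsubmxK mul_row_block mulmx0 add0r.
    case/eq_row_mx => -> ->.
    rewrite -!/(full_diff C p.+1).
    have zC (w : 'rV_(full_rank C p.+2)) : w *m full_diff C p.+1 *m full_diff C p = 0.
      by apply/(hC p); exists w.
    have zA (w : 'rV_(full_rank A p.+3)) : w *m full_diff A p.+2 *m full_diff A p.+1 = 0.
      by apply/(hA p.+1); exists w.
    rewrite mulmxN !mulNmx (zC (rsubmx v)) oppr0 oppr0 mulmxDl.
    rewrite (zA (lsubmx v)) add0r -[_ *m _ *m fdiff A p]mulmxA (cone_map_comm p.+1) mulmxA subrr.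
    by rewrite row_mx0.
  move=> h; have := h; rewrite -row_mx0 => /eq_row_mx [h1 h2].
  have /(hC p) [w hw] : b *m full_diff C p = 0 by apply/eqP; rewrite -oppr_eq0 h2.
  have /(hA p.+1) [x hx] : (a + w *m cone_map p.+2) *m full_diff A p.+1 = 0.
    rewrite mulmxDl -[w *m _ *m _]mulmxA (cone_map_comm p.+1) mulmxA -hw.
    exact: h1.
  exists (row_mx x (- w)); rewrite mul_row_block mulmx0 add0r.
  have -> : x *m fdiff A p.+1 = a + w *m cone_map p.+2 by rewrite hx.
  rewrite mulNmx addrK mulNmx mulmxN opprK.
  by congr row_mx.
Qed.

Lemma cone_homog0 : homog_mx t (faug cone).
Proof.
move=> i j; rewrite mxE; case: splitP => l _; first exact: homA0.
by rewrite ord1 mxE; case: eqP; rewrite ?mulr1n // rpred0.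
Qed.

Lemma cone_homog p : homog_mx 1 (fdiff cone p).
Proof.
move=> i j; rewrite /= mxE; case: splitP => l _; rewrite mxE; case: splitP => m _.
- exact: homA.
- by rewrite mxE rpred0.
- exact: cone_map_homog.
- by rewrite mxE rpredN; apply: homC_full.
Qed.

End Cone.

Lemma linear_res_add t I J f :
    linear_res t I -> linear_res 1 J -> f \is t.-homog ->
    (forall g, J g <-> I (g * f)) ->
  linear_res t (fun g => exists a b, I a /\ g = a + b * f).
Proof.
move=> [A [rA hA0 hA]] [C [rC hC0 hC]] hf hJ.
exists (cone A C f); split.
- exact: cone_resolves rA rC hA0 hA hC0 hC hf hJ.
- exact: cone_homog0.
- by move=> p; apply: (cone_homog rA rC hA0).
Qed.

Lemma linear_res0 t : linear_res t (fun f : R => f = 0).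
Proof.
exists (@FreeSeq k n (fun=> 0%N) (fun _ _ => 0%N) (fun _ => 0) 0).
split=> [||p]; try by case.
split=> /= [f|u|p u]; last first.
- by split=> _; [exists 0; rewrite mul0mx [LHS]thinmx0 | rewrite mulmx0].
- by split=> _; [exists 0; rewrite mul0mx [LHS]thinmx0 | rewrite mulmx0].
by split=> [->|[u ->]]; [exists 0; rewrite mulmx0 mxE | rewrite mulmx0 mxE].
Qed.

End MappingCone.

(** * Regularity and monomial ideals *)

Section Regularity.
Variables (k : fieldType) (n : nat).
Local Notation R := {mpoly k[n]}.
Implicit Types (I : R -> Prop).

Lemma dhomog_const0 e (p : R) : p \is e.+1.-homog -> p@_0%MM = 0.
Proof. by move=> hp; apply: (dhomog_nemf_coeff hp); rewrite /= mdeg0. Qed.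

Lemma const0_mulmx a b (v : 'rV[R]_a) (M : 'M[R]_(a, b)) j :
  (forall l, (M l j)@_0%MM = 0) -> ((v *m M) ord0 j)@_0%MM = 0.
Proof.
move=> hM; rewrite mxE raddf_sum big1 // => l _.
by rewrite /= rmorphM /= hM mulr0.
Qed.

(* Otherwise a basis vector would be a cycle, hence a boundary, and
   boundaries have no constant terms. *)
Lemma minimal_row_neq0 (F : free_seq k n) I p (l : 'I_(full_rank F p.+1)) :
  fs_resolves F I -> fs_minimal F -> row l (full_diff F p) <> 0.
Proof.
move=> hF hmin; rewrite rowE => /(full_diff_exact hF) [v hv].
have := const0_mulmx v (fun m => hmin p m l); rewrite -[fdiff F p]/(full_diff F p.+1) -hv mxE.
by rewrite !eqxx mcoeff1 eqxx => /eqP; rewrite oner_eq0.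
Qed.

Lemma row_neq0 a b (M : 'M[R]_(a, b)) l : row l M <> 0 -> exists m, M l m != 0.
Proof.
move=> h; apply/existsP; apply: contra_notT h; rewrite negb_exists => /forallP h.
by apply/rowP => m; rewrite !mxE; apply/eqP; rewrite -[_ == _]negbK h.
Qed.

(** By minimality each basis vector has a nonzero, nonconstant entry in its image, so shifts grow by
    at least 1 at each step, starting from at least 2. The bound [p + 2] then forces equality. *)
Lemma linear_res_of_has_reg2 I :
    (forall f d, I f -> f != 0 -> f \is d.-homog -> (2 <= d)%N) ->
  has_reg I 2 -> linear_res 2 I.
Proof.
move=> hI [F [[hd ha] hF hmin hle _]].
have hsh p (l : 'I_(frank F p)) : fshift l = (p + 2)%N.
  apply/eqP; rewrite eqn_leq hle /=; elim: p l => [|p IH] l.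
    have [m] := row_neq0 (minimal_row_neq0 (p := 0) (l := l) hF hmin).
    rewrite !ord1 => hn0; apply: (hI (faug F l ord0)) => //.
    case: hF => hF _ _; apply/hF; exists (delta_mx 0 l).
    by rewrite -rowE mxE.
  have [m hm] := row_neq0 (minimal_row_neq0 (p := p.+1) (l := l) hF hmin).
  case: (hd p l m) => [h|[e [-> he]]]; first by rewrite [_ l m]h eqxx in hm.
  have e_gt0 : (0 < e)%N; last by have := IH m; lia.
  case: e he => // he; move/eqP: hm; case; rewrite /=.
  apply/mpolyP => x; rewrite mcoeff0.
  have [->|hx] := eqVneq x 0%MM; first exact: hmin.
  by apply: (dhomog_nemf_coeff he); rewrite /= mdeg_eq0.
exists F; split=> // [l m|p l m].
  by rewrite ord1; have := ha l; rewrite hsh.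
case: (hd p l m) => [->|[e []]]; first by rewrite rpred0.
by rewrite !hsh => he; have -> : e = 1%N by lia.
Qed.

(** Linear entries have no constant term, so the resolution is minimal. A nonzero element of [I]
    provides a generator of [F_0], where the bound is attained. *)
Lemma has_reg2_of_linear_res I : (exists f, I f /\ f <> 0) ->
  linear_res 2 I -> has_reg I 2.
Proof.
move=> [f [If f0]] [F [hF h0 h1]].
exists (@FreeSeq k n (frank F) (fun p _ => p + 2)%N (fdiff F) (faug F)).
split=> //=.
- split=> /= [p l m|l]; last exact: h0.
  by right; exists 1%N; split; [lia | apply: h1].
- by move=> p l m; apply: dhomog_const0 (h1 p l m).
- exists 0%N; case: hF => /(_ f) /= hI _ _; move/hI: If => [u hu].
  case: (posnP (frank F 0)) => [z|z]; last by exists (Ordinal z).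
  by case: f0; rewrite hu mxE big1 // => l _; have := ltn_ord l; rewrite {2}z.
Qed.

End Regularity.

Section MonomialIdeals.
Variables (k : fieldType) (n : nat).
Local Notation R := {mpoly k[n]}.
Implicit Types (P : pred 'X_{1..n}) (m g : 'X_{1..n}) (f : R).

Definition mono_ideal P f : Prop := {in msupp f, forall m, P m}.

Definition up_closed P : Prop := forall m g, P m -> P (m + g)%MM.

Lemma mono_ideal_eq P Q f : P =1 Q -> mono_ideal P f <-> mono_ideal Q f.
Proof. by move=> h; split=> H m /H; rewrite h. Qed.

Lemma mono_ideal0 f : mono_ideal pred0 f <-> f = 0.
Proof.
split=> [h|->]; last by move=> m; rewrite msupp0.
apply/eqP; rewrite -msupp_eq0; case E: (msupp f) => [//|m s].
by have := h m; rewrite E mem_head => /(_ isT).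
Qed.

Lemma mono_idealP P : up_closed P -> is_ideal (@mono_ideal P).
Proof.
move=> hP; split=> [m|f g hf hg m /msuppD_le|f g hg m /msuppM_le].
- by rewrite msupp0.
- by rewrite mem_cat => /orP[/hf|/hg].
- by case/allpairsP=> -[a b] /= [_ /hg hb ->]; rewrite addmC hP.
Qed.

Lemma mono_idealX P m : mono_ideal P ('X_[m] : R) <-> P m.
Proof.
rewrite /mono_ideal msuppX; split=> [|hm m']; first by apply; rewrite inE.
by rewrite inE => /eqP ->.
Qed.

Lemma mono_idealMX P f g :
  mono_ideal P (f * 'X_[g]) <-> mono_ideal (fun m => P (g + m)%MM) f.
Proof.
split=> h m hm; first by apply: h; rewrite (perm_mem (msuppMX f g)) map_f.
by move: hm; rewrite (perm_mem (msuppMX f g)) => /mapP [m' /h hm' ->].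
Qed.

Lemma mono_ideal_sum P I f :
    is_ideal I -> (forall m, P m -> I 'X_[m]) -> mono_ideal P f -> I f.
Proof.
move=> [I0 ID IM] hI hf; rewrite [f]mpolyE big_seq.
elim/big_rec: _ => // m a hm Ia; apply: ID => //.
by rewrite -mul_mpolyC; apply/IM/hI/hf.
Qed.

Lemma mono_ideal_add P g f : up_closed P ->
  mono_ideal (fun m => P m || (g <= m)%MM) f <->
  exists a b, mono_ideal P a /\ f = a + b * 'X_[g].
Proof.
move=> hP; have idP := mono_idealP hP; split=> [|[a [b [ha ->]]]].
  apply: (@mono_ideal_sum _ (fun f => exists a b, mono_ideal P a /\ f = a + b * 'X_[g])).
    case: idP => I0 ID IM; split=> [|f1 f2 [a1 [b1 [h1 ->]]] [a2 [b2 [h2 ->]]]|c f1 [a1 [b1 [h1 ->]]]].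
    - by exists 0, 0; rewrite mul0r addr0.
    - by exists (a1 + a2), (b1 + b2); rewrite mulrDl addrACA; split=> //; apply: ID.
    - by exists (c * a1), (c * b1); rewrite mulrDr mulrA; split=> //; apply: IM.
  move=> m /orP[hm|hm].
    by exists 'X_[m], 0; rewrite mul0r addr0; split=> //; apply/mono_idealX.
  exists 0, 'X_[m - g]; rewrite add0r -mpolyXD submK //; split=> //.
  by case: idP.
have /mono_idealP [_ hD hM] : up_closed (fun m => P m || (g <= m)%MM).
  move=> m m' /orP[/hP ->//|h]; apply/orP; right.
  by apply: (lepm_trans h); apply: lem_addr.
apply: hD; first by move=> m /ha ->.
by apply: hM; apply/mono_idealX; rewrite lepm_refl orbT.
Qed.

(** The mapping cone step for monomial ideals: [J] describes the colon ideal by ['X_[g]]. *)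
Lemma linear_res_mono_add t (P J : pred 'X_{1..n}) g : up_closed P ->
    linear_res t (@mono_ideal P) -> linear_res 1 (@mono_ideal J) -> mdeg g = t ->
    (forall m, J m = P (g + m)%MM) ->
  linear_res t (@mono_ideal (fun m => P m || (g <= m)%MM)).
Proof.
move=> hP h1 h2 hg hJ.
apply: (linear_res_iff (fun f => iff_sym (mono_ideal_add g f hP))).
apply: linear_res_add h1 h2 _ _; first by rewrite dhomogX /= hg.
by move=> f; apply: iff_trans (iff_sym (mono_idealMX _ _ _)); apply: mono_ideal_eq.
Qed.

(** Variables are adjoined one at a time. The colon ideal of the earlier ones by a new variable is
    the same ideal again, so the induction hypothesis supplies both inputs of the cone. *)
Lemma linear_res_vars (vs : seq 'I_n) : uniq vs ->
  linear_res 1 (@mono_ideal (fun m => has (fun v => 0 < m v)%N vs)).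
Proof.
elim: vs => [_|v vs IH /= /andP[hv /IH {}IH]].
  by apply: linear_res_iff (@linear_res0 k n 1) => f; apply: iff_sym; apply: mono_ideal0.
pose P := fun m : 'X_{1..n} => has (fun w => 0 < m w)%N vs.
have hP : up_closed P.
  by move=> m g; apply: sub_has => w; rewrite mnmDE; lia.
apply: (linear_res_iff (I := mono_ideal (fun m => P m || (U_(v) <= m)%MM))).
  by move=> f; apply: mono_ideal_eq => m; rewrite lep1mP -lt0n orbC.
apply: (@linear_res_mono_add _ _ P) (IH) (IH) _ _ => //; first by rewrite mdeg1.
move=> m; apply: eq_in_has => w hw; rewrite mnmDE mnm1E.
by case: eqP => // e; rewrite e hw in hv.
Qed.

End MonomialIdeals.

(** * Edge ideals with linear quotients *)

Section LinearQuotients.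
Variables (k : fieldType) (n : nat) (e : rel 'I_n) (key : 'I_n -> 'I_n -> nat).
Local Notation R := {mpoly k[n]}.

Definition edge_mono (A : rel 'I_n) : pred 'X_{1..n} :=
  fun m => [exists u, exists v, A u v && (U_(u) + U_(v) <= m)%MM].

Lemma edge_monoP (A : rel 'I_n) m :
  reflect (exists u v, A u v /\ (U_(u) + U_(v) <= m)%MM) (edge_mono A m).
Proof.
apply: (iffP existsP) => [[u /existsP [v /andP[h1 h2]]]|[u [v [h1 h2]]]].
  by exists u, v.
by exists u; apply/existsP; exists v; rewrite h1.
Qed.

Lemma edge_mono_up A : up_closed (edge_mono A).
Proof.
move=> m g /edge_monoP [u [v [h1 h2]]]; apply/edge_monoP; exists u, v.
by split=> //; apply: lepm_trans h2 _; apply: lem_addr.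
Qed.

Lemma le_mnm2P (u v : 'I_n) (m : 'X_{1..n}) : u != v ->
  (U_(u) + U_(v) <= m)%MM = (0 < m u)%N && (0 < m v)%N.
Proof.
move=> uv; apply/mnm_lepP/andP => [h|[h1 h2] w].
  have := h u; have := h v; rewrite !mnmDE !mnm1E !eqxx (negbTE uv) eq_sym (negbTE uv).
  by lia.
rewrite mnmDE !mnm1E; case: (eqVneq u w) => [<-|_].
  by rewrite eq_sym (negbTE uv).
by case: (eqVneq v w) => [<-|_].
Qed.

Hypotheses (e_sym : ssrbool.symmetric e) (e_irr : irreflexive e).
Hypothesis key_sym : forall u v, key u v = key v u.
(** An earlier or tied edge [{a, b}] disjoint from [{u, v}] contributes [x_a x_b] to the colon ideal
    by [x_u x_v]. The earlier edge [{c, w}] puts [x_w], a divisor of [x_a x_b], into that ideal. *)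
Hypothesis cross : forall u v a b : 'I_n, (u < v)%N -> (a < b)%N ->
  e u v -> e a b -> [/\ a != u, a != v, b != u & b != v] ->
  (key a b <= key u v)%N ->
  exists c w, [/\ c = u \/ c = v, w = a \/ w = b, e c w & (key c w < key u v)%N].

Lemma cross_sym u v a b :
  e u v -> e a b -> [/\ a != u, a != v, b != u & b != v] ->
  (key a b <= key u v)%N ->
  exists c w, [/\ c = u \/ c = v, w = a \/ w = b, e c w & (key c w < key u v)%N].
Proof.
wlog uv : u v / (u < v)%N => [hw euv|].
  have [uv|vu|uv] := ltngtP u v; first exact: hw.
    move=> eab [h1 h2 h3 h4] hk.
    have [c [w [hc hw1 hw2 hw3]]] :=
      hw v u vu (etrans (e_sym v u) euv) eab (And4 h2 h1 h4 h3)
         (etrans (congr1 _ (key_sym v u)) hk).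
    by exists c, w; split=> //; [case: hc; [right|left] | rewrite (key_sym u v)].
  by move: euv; rewrite (ord_inj uv) e_irr.
wlog ab : a b / (a < b)%N => [hw euv eab|].
  have [ab|ba|ab] := ltngtP a b; first exact: hw.
    move=> [h1 h2 h3 h4] hk.
    have [c [w [hc hw1 hw2 hw3]]] :=
      hw b a ba euv (etrans (e_sym b a) eab) (And4 h3 h4 h1 h2)
         (etrans (congr1 (fun x => x <= _)%N (key_sym b a)) hk).
    by exists c, w; split=> //; case: hw1; [right|left].
  by move: eab; rewrite (ord_inj ab) e_irr.
exact: cross.
Qed.

(** By induction on the set of edges: an edge [{u, v}] of largest key is removed, and the colon
    ideal of the remaining edges by it is generated by variables. *)
Theorem linear_res_quotients : linear_res 2 (@mono_ideal k n (edge_mono e)).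
Proof.
pose Arel (A : {set 'I_n * 'I_n}) : rel 'I_n := fun u v => (u, v) \in A.
(* Symmetric sets of edges closed under passing to a strictly smaller key; edges with equal keys may
   be removed in any order. *)
pose good (A : {set 'I_n * 'I_n}) :=
  [/\ subrel (Arel A) e, forall u v, Arel A u v -> Arel A v u
    & forall u v a b, Arel A u v -> e a b -> (key a b < key u v)%N -> Arel A a b].
suff H N (A : {set 'I_n * 'I_n}) : good A -> (#|A| <= N)%N ->
    linear_res 2 (@mono_ideal k n (edge_mono (Arel A))).
  apply: (linear_res_iff (I := mono_ideal (edge_mono (Arel [set x | e x.1 x.2])))).
    move=> f; apply: mono_ideal_eq => m; apply: eq_existsb => u; apply: eq_existsb => v.
    by rewrite /Arel inE.
  apply: (H #|[set x | e x.1 x.2]|) => //.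
  split=> [u v|u v|u v a b]; rewrite /Arel !inE //=.
  by rewrite e_sym.
elim: N A => [|N IH] A [Ae As Ad] cA.
  apply: linear_res_iff (@linear_res0 k n 2) => f.
  apply: iff_trans (iff_sym (mono_ideal0 f)) _; apply: mono_ideal_eq => m.
  apply/esym/negbTE/edge_monoP => -[u [v []]].
  by move: cA; rewrite leqn0 cards_eq0 /Arel => /eqP ->; rewrite inE.
case: (set_0Vmem A) => [A0|[x0 hx0]].
  by apply: IH; rewrite ?A0 ?cards0 // -?A0.
case: (arg_maxnP (fun x => key x.1 x.2) hx0) => -[u v] /= Auv max_uv.
have euv : e u v := Ae _ _ Auv.
have uv : u != v by apply: contraTneq euv => ->; rewrite e_irr.
set B := A :\: [set (u, v); (v, u)].
have BE a b : Arel B a b = [&& Arel A a b, (a, b) != (u, v) & (a, b) != (v, u)].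
  by rewrite /Arel /B in_setD !inE negb_or andbC.
have B_key a b : e a b -> (key a b < key u v)%N -> Arel B a b.
  move=> eab hk; rewrite BE (Ad _ _ _ _ Auv eab hk) /=.
  by apply/andP; split; apply: contraTneq hk => -[-> ->]; rewrite -leqNgt // key_sym.
have gB : good B.
  split=> [a b|a b|a b c d]; rewrite !BE.
  - by move=> /andP[/Ae].
  - by move=> /and3P[/As -> h1 h2]; move: h1 h2; rewrite !xpair_eqE ![(b == _) && _]andbC => -> ->.
  - by move=> /andP[/max_uv hle _] ecd hk; rewrite -BE; apply: B_key (leq_trans hk hle).
(* The colon ideal is generated by the variables of the remaining neighbours of [u] or [v]. *)
pose N0 := [pred w | (w != u) && (w != v) && (Arel B u w || Arel B v w)].
pose gm := (U_(u) + U_(v))%MM : 'X_{1..n}.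
apply: (linear_res_iff (I := mono_ideal (fun m => edge_mono (Arel B) m || (gm <= m)%MM))).
  move=> f; apply: mono_ideal_eq => m.
  apply/orP/edge_monoP => [[/edge_monoP[a [b []]]|h]|[a [b [h1 h2]]]].
  - by rewrite BE => /andP[h _] h2; exists a, b.
  - by exists u, v.
  have [/eqP[e1 e2]|h3] := boolP ((a, b) == (u, v)).
    by right; rewrite /gm -e1 -e2.
  have [/eqP[e1 e2]|h4] := boolP ((a, b) == (v, u)).
    by right; rewrite /gm -e1 -e2 addmC.
  by left; apply/edge_monoP; exists a, b; rewrite BE h1 h3 h4.
apply: (@linear_res_mono_add _ _ 2 _ (fun m => has (fun w => 0 < m w)%N (enum N0))).
- exact: edge_mono_up.
- apply: IH => //.
  rewrite -ltnS; apply: leq_trans cA; apply: proper_card; apply/properP.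
  split; first exact: subsetDl.
  by exists (u, v) => //; rewrite /B !inE eqxx.
- by apply: linear_res_vars; rewrite enum_uniq.
- by rewrite mdegD !mdeg1.
move=> m; apply/hasP/edge_monoP => [[w]|[a [b [hab hm]]]].
  rewrite mem_enum inE => /andP[/andP[wu wv]] hw mw.
  have [c [hc hcw]] : exists c, c \in [:: u; v] /\ Arel B c w.
    by case/orP: hw => hw; [exists u | exists v]; rewrite !inE eqxx ?orbT.
  have cw : c != w.
    by apply: contraTneq hc => ->; rewrite !inE negb_or wu wv.
  exists c, w; split=> //; rewrite le_mnm2P // !mnmDE !mnm1E !addn_gt0 mw !orbT andbT.
  by move: hc; rewrite !inE => /orP[] /eqP ->; rewrite eqxx ?orbT.
have [Bs1 Bs2 Bs3] := gB.
have eab := Bs1 _ _ hab.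
have ab : a != b by apply: contraTneq eab => ->; rewrite e_irr.
move: hm; rewrite le_mnm2P // !mnmDE !mnm1E => /andP[ma mb].
suff [w hw mw] : exists2 w, N0 w & (0 < m w)%N by exists w; rewrite ?mem_enum.
rewrite /N0 /=.
case: (eqVneq a u) => [eau|au].
  have bu : b != u by rewrite -eau eq_sym.
  have bv : b != v.
    by apply: contraTneq hab => ->; rewrite eau BE eqxx !andbF.
  exists b; first by rewrite bu bv -eau hab.
  by move: mb; rewrite eq_sym (negbTE bu) eq_sym (negbTE bv).
case: (eqVneq a v) => [eav|av].
  have bv : b != v by rewrite -eav eq_sym.
  have bu : b != u.
    by apply: contraTneq hab => ->; rewrite eav BE eqxx !andbF.
  exists b; first by rewrite bu bv -eav hab orbT.
  by move: mb; rewrite eq_sym (negbTE bu) eq_sym (negbTE bv).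
have {}ma : (0 < m a)%N by move: ma; rewrite eq_sym (negbTE au) eq_sym (negbTE av).
case: (eqVneq b u) => [ebu|bu].
  by exists a => //; rewrite au av -ebu Bs2.
case: (eqVneq b v) => [ebv|bv].
  by exists a => //; rewrite au av -ebv (Bs2 _ _ hab) orbT.
have {}mb : (0 < m b)%N by move: mb; rewrite eq_sym (negbTE bu) eq_sym (negbTE bv).
have hk : (key a b <= key u v)%N.
  by apply: (max_uv (a, b)); move: hab; rewrite BE => /andP[].
have [c [w [hc hw ecw kcw]]] := cross_sym euv eab (And4 au av bu bv) hk.
have hB := B_key _ _ ecw kcw.
exists w; last by case: hw => ->.
have [wu wv] : w != u /\ w != v by case: hw => ->.
rewrite wu wv /=; case: hc hB => -> hB; first by rewrite hB.
by rewrite hB orbT.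
Qed.

End LinearQuotients.

(** * Exactness of the Koszul complex *)

Section DivisionByVariable.
Variables (k : fieldType) (n : nat).
Local Notation R := {mpoly k[n]}.
Implicit Types (f g : R) (m : 'X_{1..n}) (v w : 'I_n).

Lemma mcoeffXM f m w :
  ('X_w * f)@_m = if m w == 0%N then 0 else f@_(m - U_(w))%MM.
Proof.
rewrite mulrC; case: eqP => [E|/eqP E].
  apply: memN_msupp_eq0; rewrite (perm_mem (msuppMX f _)).
  by apply/mapP => -[m' _ em]; move: E; rewrite em mnmDE mnm1E eqxx.
have /submK hm : (U_(w) <= m)%MM by rewrite lep1mP.
by rewrite -[in LHS]hm addmC mcoeffMX.
Qed.

(** [mdivX] and [mzeroX] are the quotient and the remainder of the division by [x_v]. *)
Definition mdivX v f : R :=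
  \sum_(m <- msupp f | m v != 0%N) f@_m *: 'X_[m - U_(v)].

Definition mzeroX v f : R := \sum_(m <- msupp f | m v == 0%N) f@_m *: 'X_[m].

Lemma big_mcoeff_uniq f (P : pred 'X_{1..n}) m :
  \sum_(m' <- msupp f | P m') f@_m' * (m' == m)%:R = (if P m then f@_m else 0).
Proof.
rewrite big_mkcond; have [hm|hm] := boolP (m \in msupp f).
  rewrite (bigD1_seq m) //= eqxx mulr1 big1 ?addr0 // => m' /negbTE ->.
  by rewrite mulr0 if_same.
rewrite (memN_msupp_eq0 hm) if_same big_seq big1 // => m' hm'.
case: eqP => [e|_]; last by rewrite mulr0 if_same.
by rewrite -e hm' in hm.
Qed.

Lemma mcoeff_mdivX v f m : (mdivX v f)@_m = f@_(m + U_(v))%MM.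
Proof.
transitivity (\sum_(m' <- msupp f | m' v != 0%N) f@_m' * (m' == m + U_(v))%MM%:R).
  rewrite /mdivX raddf_sum /=; apply: eq_bigr => m' hv.
  rewrite mcoeffZ mcoeffX; congr (_ * _%:R); congr (nat_of_bool _).
  by rewrite -(eqm_add2r U_(v)%MM) submK // lep1mP.
by rewrite big_mcoeff_uniq mnmDE mnm1E eqxx addn1.
Qed.

Lemma mcoeff_mzeroX v f m : (mzeroX v f)@_m = if m v == 0%N then f@_m else 0.
Proof.
rewrite -(big_mcoeff_uniq f (fun m => m v == 0%N)) /mzeroX raddf_sum /=; apply: eq_bigr => m' hv.
by rewrite mcoeffZ mcoeffX.
Qed.

Lemma mdivX_additive v : zmod_morphism (mdivX v).
Proof. by move=> f g; apply/mpolyP => m; rewrite !(mcoeff_mdivX, mcoeffB). Qed.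

HB.instance Definition _ v := GRing.isZmodMorphism.Build R R (mdivX v) (mdivX_additive v).

Lemma mzeroX_additive v : zmod_morphism (mzeroX v).
Proof.
move=> f g; apply/mpolyP => m; rewrite !(mcoeff_mzeroX, mcoeffB).
by case: eqP; rewrite ?subr0.
Qed.

HB.instance Definition _ v := GRing.isZmodMorphism.Build R R (mzeroX v) (mzeroX_additive v).

Lemma mdivX_zeroX v f : f = 'X_v * mdivX v f + mzeroX v f.
Proof.
apply/mpolyP => m; rewrite mcoeffD mcoeffXM mcoeff_mdivX mcoeff_mzeroX.
by case: eqP => [|/eqP h]; rewrite ?add0r // submK ?addr0 // lep1mP.
Qed.

Lemma mdivXM v f : mdivX v ('X_v * f) = f.
Proof.
by apply/mpolyP => m; rewrite mcoeff_mdivX mcoeffXM mnmDE mnm1E eqxx addn1 addmK.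
Qed.

Lemma mdivXMneq v w f : w != v -> mdivX v ('X_w * f) = 'X_w * mdivX v f.
Proof.
move=> wv; apply/mpolyP => m; rewrite mcoeff_mdivX !mcoeffXM mcoeff_mdivX.
rewrite mnmDE mnm1E [v == w]eq_sym (negbTE wv) addn0; case: eqP => // /eqP h.
by rewrite [(m + _)%MM]addmC -addmBA ?lep1mP // addmC.
Qed.

Lemma mdivX_sign v i f : mdivX v ((-1) ^+ i * f) = (-1) ^+ i * mdivX v f.
Proof. by rewrite -signr_odd !mulr_sign; case: odd; rewrite ?raddfN. Qed.

End DivisionByVariable.

Section Koszul.
Variables (k : fieldType) (n : nat).
Local Notation R := {mpoly k[n]}.
Implicit Types (v w : 'I_n) (S : {set 'I_n}) (c : {set 'I_n} -> R).

(** Exponent of the Koszul sign for inserting [v] into [S]. *)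
Definition kexp v S := #|[set w in S | (w < v)%N]|.

Lemma kexpU v w S : v \notin S -> kexp w (v |: S) = ((v < w) + kexp w S)%N.
Proof.
move=> vS; rewrite /kexp; case: (ltnP v w) => vw.
  rewrite (_ : [set _ in _ | _] = v |: [set x in S | (x < w)%N]).
    by rewrite cardsU1 inE (negbTE vS).
  by apply/setP => x; rewrite !inE; case: eqP => // ->; rewrite vw.
apply: eq_card => x; rewrite !inE; case: eqP => // ->.
by rewrite (negbTE vS) ltnNge vw.
Qed.

(* [c S] is the coefficient of the basis vector [e_S] of the Koszul complex on
   the variables. *)
Definition koszul c S : R :=
  \sum_(v | v \notin S) (-1) ^+ kexp v S * ('X_v * c (v |: S)).

(** Exactly one of [v < w] and [w < v] holds, so the two orders of insertion differ by one sign. *)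
Lemma koszul_sign_swap v w S f : v \notin S -> w \notin S -> v != w ->
  (-1) ^+ kexp v S * ((-1) ^+ kexp w (v |: S) * f) =
  - ((-1) ^+ kexp w S * ((-1) ^+ kexp v (w |: S) * f)) :> R.
Proof.
move=> vS wS vw; rewrite !kexpU // !exprD.
have : (v < w)%N != (w < v)%N.
  by apply: contra vw => /eqP; case: (ltngtP v w) => // h _; apply/eqP/ord_inj.
by case: (v < w)%N; case: (w < v)%N => // _;
  rewrite expr0 expr1 !mul1r !mulN1r !(mulNr, mulrN) ?opprK mulrCA.
Qed.

Lemma koszul_sign_anti v w S (f : R) : v \notin S -> w \notin S -> v != w ->
  (-1) ^+ kexp w (v |: S) * ((-1) ^+ kexp v (w |: S) * f) =
  - ((-1) ^+ kexp v S * ((-1) ^+ kexp w S * f)).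
Proof.
move=> vS wS vw; rewrite !kexpU // !exprD.
have : (v < w)%N != (w < v)%N.
  by apply: contra vw => /eqP; case: (ltngtP v w) => // h _; apply/eqP/ord_inj.
by case: (v < w)%N; case: (w < v)%N => // _;
  rewrite expr0 expr1 !mul1r !mulN1r !(mulNr, mulrN) mulrCA.
Qed.

(** The terms of [(v, w)] and [(w, v)] cancel: the double sum is split by the order of its indices
    and one half is reindexed. *)
Lemma koszul_koszul c S : koszul (koszul c) S = 0.
Proof.
rewrite /koszul.
pose a v w : R := (-1) ^+ kexp v S * ((-1) ^+ kexp w (v |: S) *
  ('X_v * ('X_w * c (w |: (v |: S))))).
transitivity (\sum_(v | v \notin S) \sum_(w | (w \notin S) && (w != v)) a v w).
  apply: eq_bigr => v vS; rewrite !mulr_sumr; apply: eq_big => [w|w _].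
    by rewrite !inE negb_or andbC.
  by rewrite /a; congr (_ * _); rewrite mulrCA.
transitivity (\sum_(v | v \notin S) \sum_(w | (w \notin S) && (w < v)%N) a v w +
              \sum_(v | v \notin S) \sum_(w | (w \notin S) && (v < w)%N) a v w).
  rewrite -big_split /=; apply: eq_bigr => v vS.
  rewrite (bigID (fun w : 'I_n => (w < v)%N)) /=; congr (_ + _); apply: eq_bigl => w.
    by rewrite -andbA -val_eqE /=; case: ltngtP.
  by rewrite -andbA -val_eqE /=; case: ltngtP.
rewrite (exchange_big_dep (fun v => v \notin S)) /=; last by move=> v w _ /andP[].
rewrite -big_split big1 //= => v vS.
rewrite (eq_bigl (fun w => (w \notin S) && (v < w)%N)); last first.
  by move=> w; rewrite vS.
rewrite -big_split big1 //= => w /andP[wS vw].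
have nvw : v != w by rewrite -val_eqE /= neq_ltn vw.
rewrite /a [X in X + _]koszul_sign_swap 1?eq_sym // ['X_w * ('X_v * _)]mulrCA setUCA addNr //.
Qed.

Definition koszul_htpy v c S : R :=
  if v \in S then (-1) ^+ kexp v (S :\ v) * mdivX v (c (S :\ v)) else 0.

(** Projection onto the homology of the tensor factor of [v], which is [R_n / (x_v)], represented by
    the polynomials free of [x_v]. *)
Definition koszul_zero v c S : R := if v \in S then 0 else mzeroX v (c S).

(* The Koszul complex is the tensor product of the complexes [x_v : R -> R], and
   each of these is homotopic to its homology. *)
Lemma koszul_htpyP v c S :
  koszul (koszul_htpy v c) S + koszul_htpy v (koszul c) S = c S - koszul_zero v c S.
Proof.
have [vS|vS] := boolP (v \in S); rewrite /koszul_zero {2}/koszul_htpy ?vS ?(negbTE vS).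
  set T := S :\ v.
  have vT : v \notin T by rewrite !inE eqxx.
  have eS : S = v |: T by rewrite setD1K.
  rewrite subr0 {2}/koszul (bigD1 v) //= raddfD /= mulrDr mdivX_sign mdivXM.
  rewrite -eS mulrA -expr2 sqrr_sign mul1r addrCA.
  rewrite [X in _ + X](_ : _ = 0) ?addr0 //.
  rewrite raddf_sum mulr_sumr /koszul.
  rewrite [X in _ + X](eq_bigl (fun w => w \notin S)); last first.
    by move=> w; rewrite eS !inE negb_or andbC; case: eqP => [->|]; rewrite ?eqxx ?andbF.
  rewrite -big_split big1 //= => w wS.
  have wv : w != v by apply: contraNneq wS => ->.
  have wT : w \notin T by rewrite !inE negb_and wS orbT.
  rewrite /koszul_htpy !inE vS orbT.
  rewrite (_ : (w |: S) :\ v = w |: T); last first.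
    apply/setP => x; rewrite !inE; case: (eqVneq x v) => [->|//].
    by rewrite eq_sym (negbTE wv).
  rewrite mdivX_sign mdivXMneq // {1}eS.
  rewrite ['X_w * (_ * _)]mulrCA koszul_sign_anti ?addNr //.
  by rewrite eq_sym.
rewrite addr0 /koszul (bigD1 v) //= big1 => [|w /andP[wS wv]].
  rewrite addr0 /koszul_htpy !inE eqxx /= (_ : (v |: S) :\ v = S) ?setU1K //.
  rewrite mulrCA signrMK.
  by rewrite [X in _ = X - _](mdivX_zeroX v) addrK.
by rewrite /koszul_htpy !inE eq_sym (negbTE wv) (negbTE vS) !mulr0.
Qed.

Lemma koszulB c d S : koszul (fun T => c T - d T) S = koszul c S - koszul d S.
Proof. by rewrite /koszul -sumrB; apply: eq_bigr => v _; rewrite !mulrBr. Qed.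

Lemma koszulD c d S : koszul (fun T => c T + d T) S = koszul c S + koszul d S.
Proof. by rewrite /koszul -big_split; apply: eq_bigr => v _; rewrite !mulrDr. Qed.

Lemma eq_koszul c d : c =1 d -> koszul c =1 koszul d.
Proof. by move=> h S; apply: eq_bigr => v _; rewrite h. Qed.

Lemma koszul0 S : koszul (fun=> 0) S = 0.
Proof. by rewrite /koszul big1 // => v _; rewrite !mulr0. Qed.

(** The homotopies of all variables are applied in turn. What survives is a constant at the empty
    set, which the second hypothesis excludes. *)
Lemma koszul_exact c : (forall S, koszul c S = 0) -> (c set0)@_0%MM = 0 ->
  exists u, forall S, c S = koszul u S.
Proof.
(* Once the variables in [s] are treated, the remainder [d] vanishes on sets meeting [s], involves
   no variable of [s], and keeps the constant term at the empty set. *)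
suff H (s : seq 'I_n) : (forall S, koszul c S = 0) ->
  exists u (d : _ -> R), [/\ forall S, c S = koszul u S + d S,
    forall v S, v \in s -> v \in S -> d S = 0,
    forall v (m : 'X_{1..n}) S, v \in s -> m v != 0%N -> (d S)@_m = 0 &
    (d set0)@_0%MM = (c set0)@_0%MM].
  move=> hc h0; have [u [d [h1 h2 h3 h4]]] := H (enum 'I_n) hc.
  exists u => S; rewrite h1; suff -> : d S = 0 by rewrite addr0.
  apply/mpolyP => m; rewrite mcoeff0.
  have [->|/set0Pn [v vS]] := eqVneq S set0; last first.
    by rewrite (h2 v) ?mem_enum ?mcoeff0.
  have [->|hm] := eqVneq m 0%MM; first by rewrite h4.
  have [v hv] : exists v, m v != 0%N.
    apply/existsP; apply: contraNT hm; rewrite negb_exists => /forallP hm.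
    by apply/eqP/mnmP => v; rewrite mnm0E; apply/eqP; have := hm v; rewrite negbK.
  by apply: h3 hv; rewrite mem_enum.
move=> hc; elim: s => [|v s [u [d [h1 h2 h3 h4]]]].
  by exists (fun=> 0), c; split=> // S; rewrite koszul0 add0r.
have hd S : koszul d S = 0.
  rewrite -[RHS](hc S) (eq_koszul h1) koszulD -[X in X + _]/(koszul (koszul u) S).
  by rewrite koszul_koszul add0r.
exists (fun S => u S + koszul_htpy v d S), (koszul_zero v d); split.
- move=> S; rewrite koszulD -addrA h1; congr (_ + _).
  have e0 : koszul_htpy v (koszul d) S = 0.
    by rewrite /koszul_htpy hd raddf0 mulr0 if_same.
  by have := koszul_htpyP v d S; rewrite e0 addr0 => ->; rewrite subrK.
- move=> w S; rewrite inE /koszul_zero => /orP[/eqP ->|hw] wS; first by rewrite wS.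
  by case: ifP => // _; rewrite (h2 w) ?raddf0.
- move=> w m S; rewrite inE /koszul_zero => hw mw.
  case: ifP => [|_]; first by rewrite mcoeff0.
  rewrite mcoeff_mzeroX; case: ifP => // mv.
  case/orP: hw => [/eqP ew|hw]; first by rewrite ew mv in mw.
  exact: h3 hw mw.
- by rewrite /koszul_zero inE mcoeff_mzeroX mnm0E eqxx.
Qed.

End Koszul.

Section KoszulVector.
Variables (k : fieldType) (n : nat).
Local Notation R := {mpoly k[n]}.
Implicit Types (S : {set 'I_n}).

Definition koszulv a (y : {set 'I_n} -> 'rV[R]_a) S : 'rV[R]_a :=
  \row_l koszul (fun T => y T ord0 l) S.

Lemma eq_koszulv a (y z : {set 'I_n} -> 'rV[R]_a) : y =1 z -> koszulv y =1 koszulv z.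
Proof. by move=> h S; apply/rowP => l; rewrite !mxE; apply: eq_koszul => T; rewrite h. Qed.

Lemma koszulv0 a (y : {set 'I_n} -> 'rV[R]_a) S :
  (forall T, y T = 0) -> koszulv y S = 0.
Proof.
move=> y0; apply/rowP => l; rewrite !mxE /koszul big1 // => v _.
by rewrite y0 mxE !mulr0.
Qed.

Lemma koszulv_mulmx a b (y : {set 'I_n} -> 'rV[R]_a) (E : 'M_(a, b)) S :
  koszulv (fun T => y T *m E) S = koszulv y S *m E.
Proof.
apply/rowP => l; rewrite !mxE /koszul.
under eq_bigr => v _ do rewrite mxE !mulr_sumr.
rewrite exchange_big; apply: eq_bigr => i _; rewrite mxE /koszul mulr_suml.
by apply: eq_bigr => v _; rewrite !mulrA.
Qed.

Lemma koszulvv a (y : {set 'I_n} -> 'rV[R]_a) S : koszulv (koszulv y) S = 0.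
Proof.
apply/rowP => l; rewrite !mxE -[RHS](koszul_koszul (fun T => y T ord0 l) S).
by apply: eq_koszul => T; rewrite mxE.
Qed.

Lemma koszulvB a (y z : {set 'I_n} -> 'rV[R]_a) S :
  koszulv (fun T => y T - z T) S = koszulv y S - koszulv z S.
Proof.
apply/rowP => l; rewrite !mxE -koszulB.
by apply: eq_koszul => T; rewrite !mxE.
Qed.

Lemma koszulv_exact a (y : {set 'I_n} -> 'rV[R]_a) :
    (forall S, koszulv y S = 0) -> (forall l, (y set0 ord0 l)@_0%MM = 0) ->
  exists u, forall S, y S = koszulv u S.
Proof.
move=> hy h0.
have /fin_all_exists [u hu] l : exists u, forall S, y S ord0 l = koszul u S.
  apply: koszul_exact => // S.
  by have /rowP /(_ l) := hy S; rewrite !mxE.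
exists (fun S => \row_l u l S) => S; apply/rowP => l; rewrite mxE hu.
by apply: eq_koszul => T; rewrite mxE.
Qed.

End KoszulVector.

(** * Cohomology of clique complexes *)

Section CliqueComplexCohomology.
Variables (k : fieldType) (n : nat).
Local Notation R := {mpoly k[n]}.
Implicit Types (S T : {set 'I_n}) (I : R -> Prop).

Lemma koszul_homog d (z : {set 'I_n} -> R) S :
  (forall T, z T \is d.-homog) -> koszul z S \is d.+1.-homog.
Proof.
move=> hz; apply: rpred_sum => v _; rewrite -signr_odd mulr_sign.
have h : 'X_v * z (v |: S) \is d.+1.-homog.
  by rewrite -addn1 addnC; apply: dhomogM => //; rewrite dhomogX /= mdeg1.
by case: odd; rewrite ?rpredN.
Qed.

Lemma koszulv_homog d a (y : {set 'I_n} -> 'rV[R]_a) S :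
  (forall T, homog_mx d (y T)) -> homog_mx d.+1 (koszulv y S).
Proof. by move=> hy i l; rewrite ord1 mxE; apply: koszul_homog => T; apply: hy. Qed.

Section LinearResolution.
Variables (I : R -> Prop) (F : free_seq k n).
Hypotheses (resF : fs_resolves F I) (homF : forall p, homog_mx 1 (fdiff F p)).

(** Chase in the double complex formed by the Koszul complex and the resolution. Each step moves one
    place up the resolution and lowers by one the bound on the sizes of the sets supporting [y], so
    it ends. *)
Lemma koszul_chase i p (y : {set 'I_n} -> 'rV[R]_(full_rank F p.+1)) :
    (forall S, homog_mx 1 (y S)) -> (forall S, (i <= #|S|)%N -> y S = 0) ->
    (forall S, koszulv (fun T => y T *m full_diff F p) S = 0) ->
  exists u : {set 'I_n} -> 'rV[R]_(full_rank F p.+1),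
    forall S, y S *m full_diff F p = koszulv (fun T => u T *m full_diff F p) S.
Proof.
elim: i p y => [|i IH] p y hy yz cy.
  exists (fun=> 0) => S; rewrite yz // mul0mx koszulv0 //.
(* The Koszul differential of [y] is a cycle of the resolution; its lift [y'] has linear entries and
   smaller support, so the induction hypothesis applies to it. *)
have /fin_all_exists [y' hy'] S : exists x : 'rV[R]_(full_rank F p.+2),
    [/\ homog_mx 1 x, (i <= #|S|)%N -> x = 0 & x *m full_diff F p.+1 = koszulv y S].
  have [iS|iS] := leqP i #|S|.
    exists 0; split=> //; first by move=> a b; rewrite mxE rpred0.
    rewrite mul0mx; apply/esym/rowP => l; rewrite !mxE /koszul big1 // => v vS.
    by rewrite yz ?mxE ?mulr0 // cardsU1 vS add1n.
  case: (@homog_mx_lift k n 1 1 _ _ _ (full_diff F p.+1) (koszulv y S)) => [|||x h1 h2].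
  - exact: homF.
  - exact: koszulv_homog.
  - move=> l; apply/(full_diff_exact resF); rewrite ord1.
    rewrite (_ : row 0 _ = koszulv y S); last by apply/rowP => m; rewrite mxE.
    by rewrite -koszulv_mulmx.
  by exists x; split=> // /(leq_trans iS); rewrite ltnn.
have [u' hu'] : exists u : {set 'I_n} -> 'rV[R]_(full_rank F p.+2),
    forall S, y' S *m full_diff F p.+1 = koszulv (fun T => u T *m full_diff F p.+1) S.
  apply: IH => S; try by case: (hy' S).
  rewrite (eq_koszulv (z := koszulv y)) ?koszulvv // => T.
  by case: (hy' T).
(* The linearity of [y] and of the differential excludes constant terms, the only obstruction to
   Koszul exactness. *)
have [|l|u hu] := @koszulv_exact k n _ (fun S => y S - u' S *m full_diff F p.+1).
- move=> S; rewrite koszulvB -hu'; case: (hy' S) => _ _ ->; exact: subrr.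
- rewrite !mxE mcoeffB (dhomog_const0 (hy _ _ _)) sub0r.
  apply/eqP; rewrite oppr_eq0; apply/eqP.
  have := @const0_mulmx k n _ _ (u' set0) (full_diff F p.+1) l; rewrite mxE; apply => m.
  exact: dhomog_const0 (homF _ _).
exists u => S; rewrite koszulv_mulmx.
have -> : y S = koszulv u S + u' S *m full_diff F p.+1 by rewrite -hu subrK.
rewrite mulmxDl.
suff -> : u' S *m full_diff F p.+1 *m full_diff F p = 0 by rewrite addr0.
by apply/(full_diff_exact resF); exists (u' S).
Qed.

End LinearResolution.

(** Koszul cycles modulo [I] with quadratic coefficients are boundaries modulo [I]: the part of
    degree [p + 2] of the [p]-th Tor of [R_n / I] and [k] vanishes. The chase yields [b] with values
    in [I] and the same Koszul differential as [z], so [z - b] is a true cycle. *)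
Lemma linear_res_koszul I (z : {set 'I_n} -> R) :
    linear_res 2 I -> (forall S, z S \is 2.-homog) -> (forall S, I (koszul z S)) ->
  exists w, forall S, I (z S - koszul w S).
Proof.
move=> [F [hF hom0 homF]] hz Iz.
have [hI _ _] := hF.
have /fin_all_exists2 [y hy1 hy2] S : exists2 x : 'rV[R]_(full_rank F 1),
    homog_mx 1 x & x *m full_diff F 0 = (koszul z S)%:M.
  apply: (@homog_mx_lift k n 1 2); first exact: hom0.
    by move=> i l; rewrite !ord1 mxE eqxx mulr1n; apply: koszul_homog.
  move=> i; have /hI [u hu] := Iz S; exists u.
  by apply/matrixP => a b; rewrite !ord1 !mxE eqxx mulr1n hu mxE.
(* No set of vertices has [n.+1] elements, so the support condition holds at the start. *)
have [|S|u hu] := koszul_chase (i := n.+1) (p := 0) hF homF hy1.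
- by move=> S; rewrite leqNgt ltnS -[n in (_ <= n)%N]card_ord max_card.
- rewrite (eq_koszulv hy2); apply/rowP => l; rewrite ord1 !mxE.
  rewrite -[RHS](koszul_koszul z S).
  by apply: eq_koszul => T; rewrite mxE eqxx mulr1n.
pose b S := (u S *m faug F) ord0 ord0.
have hb S : koszul b S = koszul z S.
  have /rowP /(_ ord0) := hu S; rewrite hy2 !mxE eqxx mulr1n => ->.
  by apply: eq_koszul.
have [|| w hw] := @koszul_exact k n (fun S => z S - b S).
- by move=> S; rewrite koszulB hb subrr.
- rewrite mcoeffB (dhomog_const0 (hz _)) sub0r; apply/eqP; rewrite oppr_eq0; apply/eqP.
  apply: const0_mulmx => l; exact: dhomog_const0 (hom0 _ _).
exists w => S; rewrite -hw opprB addrC subrK.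
by apply/hI; exists (u S).
Qed.

Variables (e : rel 'I_n) (W : {set 'I_n}) (c : 'I_n -> 'I_n -> k).
Hypotheses (e_sym : ssrbool.symmetric e) (e_irr : irreflexive e).
Hypothesis cocycle : forall u v w : 'I_n, (u < v < w)%N ->
  [/\ u \in W, v \in W & w \in W] -> [/\ ~~ e u v, ~~ e v w & ~~ e u w] ->
  c u v + c v w = c u w.

(** On an edge the value is set to 0; since [x_u x_v] is then in the ideal, this changes nothing
    modulo the ideal. *)
Definition cochain_val u v : R := if e u v then 0 else (c u v)%:MP.

Definition cochain_term u v : R :=
  (-1) ^+ (kexp u W + kexp v W) * (cochain_val u v * ('X_u * 'X_v)).

(* The image of the 1-cochain [c] in the squarefree multidegree [W]. *)
Definition cochain_koszul S : R :=
  if [pick p : 'I_n * 'I_n | [&& p.1 \in W, p.2 \in W, (p.1 < p.2)%N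
        & S == W :\: [set p.1; p.2]]] is Some p
  then cochain_term p.1 p.2 else 0.

Lemma cochain_koszulE u v : u \in W -> v \in W -> (u < v)%N ->
  cochain_koszul (W :\: [set u; v]) = cochain_term u v.
Proof.
move=> uW vW uv; rewrite /cochain_koszul; case: pickP => [[a b] /=|]; last first.
  by move/(_ (u, v)); rewrite /= uW vW uv eqxx.
move=> /and4P[aW bW ab /eqP h].
have sub x : x \in W -> (x \in [set u; v]) = (x \in [set a; b]).
  by move=> xW; have /setP /(_ x) := h; rewrite !in_setD xW !andbT => /negb_inj.
have := sub u uW; rewrite !inE eqxx /= => /esym.
have := sub v vW; rewrite !inE eqxx orbT /= => /esym.
case/orP => /eqP ev /orP[] /eqP eu; move: uv; rewrite eu ev => // uv.
- by rewrite ltnn in uv.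
- by have := ltn_trans uv ab; rewrite ltnn.
- by rewrite ltnn in uv.
Qed.

Lemma cochain_koszul_neq0 S : cochain_koszul S != 0 ->
  exists u v, [/\ u \in W, v \in W, (u < v)%N & S = W :\: [set u; v]].
Proof.
rewrite /cochain_koszul; case: pickP => [[a b] /= /and4P[? ? ? /eqP ?] _|_]; last by rewrite eqxx.
by exists a, b.
Qed.

Lemma cochain_koszul_homog S : cochain_koszul S \is 2.-homog.
Proof.
rewrite /cochain_koszul; case: pickP => [[u v] _|_]; last by rewrite rpred0.
rewrite /cochain_term -signr_odd mulr_sign /=.
suff h : cochain_val u v * ('X_u * 'X_v) \is 2.-homog by case: odd; rewrite ?rpredN.
rewrite /cochain_val; case: ifP => _; first by rewrite mul0r rpred0.
rewrite mul_mpolyC; apply: rpredZ; rewrite -mpolyXD dhomogX /=.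
by rewrite mdegD !mdeg1.
Qed.

Lemma mono_ideal_triple (a b d : 'I_n) (s : R) : (a < b < d)%N ->
    e a b || e b d || e a d ->
  mono_ideal (edge_mono e) (s * ('X_a * ('X_b * 'X_d))).
Proof.
move=> /andP[ab bd] h; have [_ _ hM] := mono_idealP k (@edge_mono_up n e).
apply: hM; rewrite -!mpolyXD; apply/mono_idealX/edge_monoP.
have ne (x y : 'I_n) : (x < y)%N -> x != y by move=> xy; rewrite -val_eqE neq_ltn xy.
have ad := ltn_trans ab bd.
case/orP: h => [/orP[]|] h; [exists a, b | exists b, d | exists a, d]; split=> //;
  by rewrite le_mnm2P ?ne // !mnmDE !mnm1E !addn_gt0 !eqxx ?orbT.
Qed.

(** A nonzero term forces [S] to be [W] minus three vertices. If two of them are adjacent, their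
    cubic monomial is in the ideal; otherwise the cocycle condition kills its coefficient. *)
Lemma koszul_cochain S : mono_ideal (edge_mono e) (koszul cochain_koszul S).
Proof.
have idI := mono_idealP k (@edge_mono_up n e).
have [I0 ID IM] := idI.
have [/existsP [x /andP[xS hx]]|h0] :=
    boolP [exists x, (x \notin S) && (cochain_koszul (x |: S) != 0)]; last first.
  rewrite /koszul big1 // => v vS; apply/eqP.
  move: h0; rewrite negb_exists => /forallP /(_ v); rewrite vS negbK => /eqP ->.
  by rewrite !mulr0.
have [u [v [uW vW uv hS]]] := cochain_koszul_neq0 hx.
have /and4P[xW xu xv _] : [&& x \in W, x != u, x != v & true].
  by have := setU11 x S; rewrite hS !inE negb_or => /andP[/andP[-> ->] ->].
have [uS vS] : u \notin S /\ v \notin S.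
  split; apply: contraTN isT => h.
    by have := setU1r x h; rewrite hS !inE eqxx.
  by have := setU1r x h; rewrite hS !inE eqxx orbT.
have SW y : y \in S -> y \in W.
  by move=> h; have := setU1r x h; rewrite hS !inE => /andP[].
have hW y : y \in W -> [|| y == x, y == u, y == v | y \in S].
  move=> yW; have [//|yx /=] := eqVneq y x; have [//|yu /=] := eqVneq y u.
  have [//|yv /=] := eqVneq y v.
  have : y \in x |: S by rewrite hS !inE negb_or yu yv yW.
  by rewrite !inE (negbTE yx).
clear hS hx.
have [a [b [d [/andP[ab bd] [aW bW dW] [aS bS dS]] hW']]] : exists a b d : 'I_n,
  [/\ (a < b < d)%N, [/\ a \in W, b \in W & d \in W], [/\ a \notin S, b \notin S & d \notin S] &
  forall y, y \in W -> [|| y == a, y == b, y == d | y \in S]].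
  have [xu'|xu'|/ord_inj E] := ltngtP x u; last by rewrite E eqxx in xu.
    exists x, u, v; split=> //; first by rewrite xu'.
  have [xv'|xv'|/ord_inj E] := ltngtP x v; last by rewrite E eqxx in xv.
    exists u, x, v; split=> //; first by rewrite xu'.
    by move=> y /hW; rewrite orbCA.
  exists u, v, x; split=> //; first by rewrite uv.
  by move=> y /hW; case: (y == x) (y == u) (y == v) => [] [] [].
clear x u v uW vW uv xS xW xu xv uS vS hW.
have neW (x y : 'I_n) : (x < y)%N -> x != y by move=> xy; rewrite -val_eqE neq_ltn xy.
have nab := neW _ _ ab; have nbd := neW _ _ bd; have ad := ltn_trans ab bd.
have nad := neW _ _ ad.
have eW : W = a |: (b |: (d |: S)).
  apply/setP => y; rewrite !inE; apply/idP/idP; first exact: hW'.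
  by case/or4P => [/eqP->|/eqP->|/eqP->|/SW].
have bdS : b \notin d |: S by rewrite !inE negb_or nbd.
have abdS : a \notin b |: (d |: S) by rewrite !inE !negb_or nab nad.
have kW y : kexp y W = ((a < y) + ((b < y) + ((d < y) + kexp y S)))%N.
  by rewrite eW !kexpU.
have tm (x y z : 'I_n) : (y < z)%N -> y \in W -> z \in W -> W = x |: (y |: (z |: S)) ->
    x \notin S -> x != y -> x != z -> y \notin S -> z \notin S ->
  cochain_koszul (x |: S) = cochain_term y z.
  move=> yz yW zW eW' xS xy xz yS zS; rewrite -cochain_koszulE //; congr cochain_koszul.
  apply/setP => w; rewrite eW' !inE.
  case: (eqVneq w x) => [->|_]; first by rewrite negb_or xy xz.
  case: (eqVneq w y) => [->|_] /=; first by rewrite (negbTE yS).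
  by case: (eqVneq w z) => [->|_] //=; rewrite (negbTE zS).
have ta : cochain_koszul (a |: S) = cochain_term b d by apply: tm.
have tb : cochain_koszul (b |: S) = cochain_term a d.
  by apply: tm => //; rewrite 1?eq_sym // setUCA.
have td : cochain_koszul (d |: S) = cochain_term a b.
  apply: tm => //; rewrite 1?eq_sym // eW.
  by rewrite [in LHS](setUCA [set b]) setUCA.
(* Up to sign, the coboundary of [cochain_val] on the triple [a < b < d]. *)
pose s : R := (-1) ^+ (kexp a S + kexp b S + kexp d S) *
  (cochain_val a d - cochain_val b d - cochain_val a b).
have -> : koszul cochain_koszul S = s * ('X_a * ('X_b * 'X_d)).
  rewrite /koszul (bigD1 a) //= (bigD1 b) /=; last by rewrite bS eq_sym.
  rewrite (bigD1 d) /=; last by rewrite dS ![d == _]eq_sym nad nbd.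
  rewrite big1 ?addr0 => [|y /andP[/andP[/andP[yS ya] yb] yd]]; last first.
    apply/eqP; rewrite !mulf_eq0; apply/orP; right; apply/orP; right; apply/negPn/negP.
    move=> /cochain_koszul_neq0 [u [v [_ _ _ hS]]].
    have yW : y \in W by have := setU11 y S; rewrite hS inE => /andP[].
    by have := hW' y yW; rewrite (negbTE ya) (negbTE yb) (negbTE yd) (negbTE yS).
  rewrite ta tb td /cochain_term /s !kW !ltnn ab bd ad.
  rewrite ![(b < a)%N]ltnNge ![(d < b)%N]ltnNge ![(d < a)%N]ltnNge (ltnW ab) (ltnW bd) (ltnW ad) /=.
  rewrite !exprD; set x := (-1) ^+ kexp a S; set y := (-1) ^+ kexp b S.
  by set z := (-1) ^+ kexp d S; ring.
have [h|] := boolP (e a b || e b d || e a d); first by apply: mono_ideal_triple; rewrite ?ab.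
rewrite !negb_or => /andP[/andP[h1 h2] h3].
rewrite (_ : s = 0) ?mul0r // /s /cochain_val (negbTE h1) (negbTE h2) (negbTE h3).
rewrite -(@cocycle a b d) ?ab //.
by rewrite mpolyCD addrK subrr mulr0.
Qed.

Lemma kexp_pair u v : u \in W -> v \in W -> (u < v)%N ->
  kexp u (W :\: [set u; v]) = kexp u W /\ (kexp v (W :\: [set u; v])).+1 = kexp v W.
Proof.
move=> uW vW uv; set S := W :\: _.
have vS : v \notin S by rewrite !inE eqxx orbT.
have uvS : u \notin v |: S.
  by rewrite !inE eqxx /= orbF -val_eqE neq_ltn uv.
have -> : W = u |: (v |: S).
  apply/setP => y; rewrite !inE; case: (eqVneq y u) => [->//|_].
  by case: (eqVneq y v) => [->|].
by rewrite !kexpU // !ltnn uv ltnNge (ltnW uv).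
Qed.

(* The first cohomology of the clique complex of the complement of [e] on [W]
   vanishes, with coefficients in [k]. *)
Theorem linear_res_coboundary : linear_res 2 (@mono_ideal k n (edge_mono e)) ->
  exists f : 'I_n -> k, forall u v : 'I_n, u \in W -> v \in W -> (u < v)%N ->
    ~~ e u v -> c u v = f v - f u.
Proof.
move=> hlin.
have [w hw] := linear_res_koszul hlin cochain_koszul_homog koszul_cochain.
(* The potential is read off from [w] in the squarefree multidegree [W]; the sign is that of [x]
   inside [W]. *)
exists (fun x => (-1) ^+ kexp x W * (w (W :\ x))@_(U_(x))%MM) => u v uW vW uv huv.
have nuv : u != v by rewrite -val_eqE neq_ltn uv.
pose S := W :\: [set u; v]; pose m := (U_(u) + U_(v))%MM : 'X_{1..n}.
have [ku kv] := kexp_pair uW vW uv.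
(* As [{u, v}] is not an edge, [x_u x_v] is not in the ideal, so the congruence is an equality in
   this coefficient. *)
have : (cochain_koszul S - koszul w S)@_m = 0.
  apply: memN_msupp_eq0; apply/negP => /(hw S) /edge_monoP [a [b [hab]]].
  have ab : a != b by apply: contraTneq hab => ->; rewrite e_irr.
  rewrite le_mnm2P // !mnmDE !mnm1E !addn_gt0 !lt0b => /andP[].
  case/orP => /eqP ea /orP[] /eqP eb; move: hab huv; rewrite -ea -eb ?e_irr //.
    by move=> ->.
  by rewrite e_sym => ->.
rewrite mcoeffB cochain_koszulE // /cochain_term /cochain_val (negbTE huv).
rewrite -signr_odd mulr_sign -mpolyXD -/m.
have -> : (koszul w S)@_m = (-1) ^+ kexp u W * (w (W :\ v))@_(U_(v))%MM
    + (-1) ^+ kexp v S * (w (W :\ u))@_(U_(u))%MM.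
  rewrite /koszul raddf_sum /= (bigD1 u) /=; last by rewrite !inE eqxx.
  rewrite (bigD1 v) /=; last by rewrite !inE eqxx orbT eq_sym.
  rewrite big1 ?addr0 => [|x /andP[/andP[_ xu] xv]]; last first.
    rewrite -signr_odd mulr_sign; case: odd; rewrite ?mcoeffN mcoeffXM;
    by rewrite mnmDE !mnm1E ![_ == x]eq_sym (negbTE xu) (negbTE xv) ?oppr0.
  have eu : u |: S = W :\ v.
    apply/setP => y; rewrite !inE; case: (eqVneq y u) => [->|//].
    by rewrite nuv uW.
  have ev : v |: S = W :\ u.
    apply/setP => y; rewrite !inE; case: (eqVneq y v) => [->|]; last by rewrite orbF.
    by rewrite eq_sym nuv vW.
  rewrite eu ev ku.
  have cs i (f : R) : ((-1) ^+ i * f)@_m = (-1) ^+ i * f@_m.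
    by rewrite -[in LHS]signr_odd -[in RHS]signr_odd !mulr_sign; case: (odd i); rewrite ?mcoeffN.
  rewrite !cs !mcoeffXM !mnmDE !mnm1E !eqxx eq_sym (negbTE nuv) /=.
  by rewrite /m addmK addmC addmK.
have -> : (if odd (kexp u W + kexp v W) then - ((c u v)%:MP * 'X_[m]) else (c u v)%:MP * 'X_[m])@_m
  = (-1) ^+ (kexp u W + kexp v W) * c u v.
  by rewrite -[(-1) ^+ _]signr_odd mulr_sign; case: odd; rewrite ?mcoeffN mcoeffCM mcoeffX eqxx mulr1.
rewrite -kv exprD exprS; set x := (-1) ^+ kexp u W; set y := (-1) ^+ kexp v S.
have xx : x * x = 1 by rewrite -expr2 sqrr_sign.
have yy : y * y = 1 by rewrite -expr2 sqrr_sign.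
set p := (w _)@__; set q := (w _)@__ => h.
have h2 : x * y * (- 1 * (x * y) * c u v) = x * y * (x * p + y * q).
  by congr (_ * _); rewrite mulN1r; apply/eqP; rewrite -subr_eq0 -h; apply/eqP; ring.
transitivity (- (x * y * (- 1 * (x * y) * c u v))).
  by rewrite (_ : - _ = (x * x) * (y * y) * c u v); [rewrite xx yy !mul1r | ring].
rewrite h2 (_ : - _ = - ((x * x) * y * p + (y * y) * x * q)); last by ring.
by rewrite xx yy; ring.
Qed.

End CliqueComplexCohomology.

(** * Edges of the graphs of a chain *)

Section ChainIdeals.
Variables (k : fieldType) (I : forall n : nat, {mpoly k[n]} -> Prop).
Arguments I : clear implicits.
Variables (r s : nat) (i j : nat -> nat).

(* The pairs [u < v] that are images of an edge [{i t, j t}] under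
   [Inc_{r,n}]. *)
Definition chain_edge n u v : bool :=
  has (fun t => [&& i t <= u, j t + u <= v + i t & v + r <= n + j t]%N) (iota 0 s).

Definition chain_rel n : rel 'I_n := fun u v => chain_edge n u v || chain_edge n v u.

Lemma chain_edgeP n u v : reflect (exists t, [/\ (t < s)%N, (i t <= u)%N,
  (j t + u <= v + i t)%N & (v + r <= n + j t)%N]) (chain_edge n u v).
Proof.
apply: (iffP hasP) => [[t]|[t [h1 h2 h3 h4]]].
  by rewrite mem_iota /= => h /and3P[? ? ?]; exists t.
by exists t; rewrite ?mem_iota // h2 h3 h4.
Qed.

Lemma inc_gap pi a b : Inc pi -> (a <= b)%N -> (pi a + (b - a) <= pi b)%N.
Proof.
move=> hpi /subnKC <-; elim: (b - a)%N => [|c IH]; first by rewrite addn0 subnn addn0.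
by have := hpi (a + c)%N (a + c.+1)%N; lia.
Qed.

(** An increasing map with [a] sent to [u] and [b] to [v]. Beyond [b] it grows as slowly as
    possible, so for [b < r] it keeps [r - 1] below [n] exactly when [v + r <= n + b]. *)
Definition inc_ext a b u v x : nat :=
  if (x < a)%N then x else if (x < b)%N then (u + (x - a))%N else (v + (x - b))%N.

Lemma inc_extP a b u v : (a < b)%N -> (a <= u)%N -> (b + u <= v + a)%N ->
  Inc (inc_ext a b u v).
Proof.
move=> ab au bv x y xy; rewrite /inc_ext.
by case: (ltnP x a); case: (ltnP y a); case: (ltnP x b); case: (ltnP y b); lia.
Qed.

Lemma inc_act_edge n (pi : nat -> nat) (a b : 'I_r) (u v : 'I_n) : pi a = u -> pi b = v ->
  inc_act n pi ('X_a * 'X_b : {mpoly k[r]}) = 'X_u * 'X_v.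
Proof.
have X c (w : 'I_n) : pi (c : 'I_r) = w ->
  'X_c \mPo [tuple oapp (fun l : 'I_n => 'X_l : {mpoly k[n]}) 0 (insub (pi c)) | c < r] = 'X_w.
  by move=> e; rewrite comp_mpolyXU -tnth_nth tnth_mktuple e valK.
by move=> ha hb; rewrite /inc_act rmorphM /= (X _ _ ha) (X _ _ hb).
Qed.

Lemma chain_edge_lt n u v : (forall t, (t < s)%N -> (i t < j t)%N) ->
  chain_edge n u v -> (u < v)%N.
Proof. by move=> hij /chain_edgeP [t [/hij h _ h2 _]]; lia. Qed.

Lemma chain_rel_irr n : (forall t, (t < s)%N -> (i t < j t)%N) ->
  irreflexive (@chain_rel n).
Proof.
move=> hij u; apply/negbTE/negP; rewrite /chain_rel orbb.
by move=> /(chain_edge_lt hij); rewrite ltnn.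
Qed.

Lemma chain_rel_sym n : ssrbool.symmetric (@chain_rel n).
Proof. by move=> u v; rewrite /chain_rel orbC. Qed.

Hypotheses (hchain : Inc_invariant_chain I) (r_gt0 : (0 < r)%N).
Hypotheses (hedge : is_edge_ideal (I r)) (hstab : stabilizes_at I r).
Hypothesis (hE : lex_edge_enum (edge_graph (I r)) s i j).

Lemma ideal_gen_sub n (B : {mpoly k[n]} -> Prop) f : B f -> ideal_gen B f.
Proof. by move=> Bf J _; apply. Qed.

Lemma chain_relP (n : nat) (u v : 'I_n) :
  (r <= n)%N -> chain_rel u v -> I n ('X_u * 'X_v).
Proof.
move=> rn; wlog: u v / chain_edge n u v.
  move=> H /orP[h|h]; first by apply: H => //; rewrite /chain_rel h.
  by rewrite mulrC; apply: H => //; rewrite /chain_rel h.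
move=> /chain_edgeP [t [ts iu ju jv]] _.
case: hE => hij hG _ _; have /andP[ij jr] := hij t ts.
have ir := ltn_trans ij jr.
have hI : edge_graph (I r) (Ordinal ir) (Ordinal jr) by apply/hG => //; exists t.
apply/(hstab rn); apply: ideal_gen_sub.
exists (inc_ext (i t) (j t) u v), ('X_(Ordinal ir) * 'X_(Ordinal jr)); split.
- split; first exact: inc_extP.
  by rewrite /inc_ext; case: (ltnP r.-1 (i t)); case: (ltnP r.-1 (j t)); lia.
- by case: hI.
- apply/esym/inc_act_edge; rewrite /inc_ext /=; first by rewrite ltnn ij subnn addn0.
  by rewrite ltnn ltnNge (ltnW ij) subnn addn0.
Qed.

Let hlt t : (t < s)%N -> (i t < j t)%N.
Proof. by case: hE => hij _ _ _ /hij /andP[]. Qed.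

(** [inc_ext] realizes every pair of [chain_rel] as an image of an edge of [G_r]; conversely,
    increasing maps never shrink gaps, which gives the three inequalities. *)
Lemma chain_idealP n f : (r <= n)%N -> I n f <-> mono_ideal (edge_mono (@chain_rel n)) f.
Proof.
move=> rn; have idK := mono_idealP k (@edge_mono_up n (@chain_rel n)).
have idI : is_ideal (I n) by case: hchain => h _; apply: h; lia.
split; last first.
  apply: mono_ideal_sum => // m /edge_monoP [u [v [huv hm]]].
  case: idI => _ _ hM; rewrite -(submK hm) mpolyXD mpolyXD; apply: hM.
  exact: chain_relP.
move=> /(hstab rn); apply => // _ [pi [g [[hpi pin] Ig ->]]].
have [B [hB hBI]] := hedge.
(* The preimage of an ideal under [inc_act] is an ideal, so it suffices to treat quadratic
   generators. *)
apply: (proj1 (hBI g) Ig (fun f => mono_ideal (edge_mono (@chain_rel n)) (inc_act n pi f))).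
  case: idK => K0 KD KM; rewrite /inc_act; split.
  - by rewrite raddf0.
  - by move=> f1 f2 h1 h2; rewrite raddfD; apply: KD.
  - by move=> f1 f2 h2; rewrite rmorphM; apply: KM.
move: g Ig => _ _ g Bg; have [a [b [ab eg]]] := hB g Bg.
have : I r g by apply: (proj2 (hBI g)); apply: ideal_gen_sub.
rewrite {g Bg}eg; wlog ab' : a b ab / (a < b)%N.
  move=> H h; have [ba|ba|/ord_inj ba] := ltngtP a b; first exact: H.
    by rewrite mulrC; apply: H; rewrite 1?eq_sym // mulrC.
  by rewrite ba eqxx in ab.
move=> Iab; case: hE => hij hG _ _.
have /hG [] // : edge_graph (I r) a b by split.
move=> t [ts it jt].
have g0 := @inc_gap pi 0 a hpi isT; have gab := inc_gap hpi (ltnW ab').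
have gbr : (pi b + (r.-1 - b) <= pi r.-1)%N by apply: inc_gap => //; have := ltn_ord b; lia.
have br := ltn_ord b.
have un : (pi a < n)%N by lia.
have vn : (pi b < n)%N by lia.
rewrite (@inc_act_edge _ _ _ _ (Ordinal un) (Ordinal vn)) //.
rewrite -mpolyXD; apply/mono_idealX/edge_monoP; exists (Ordinal un), (Ordinal vn).
split=> //; last exact: lepm_refl.
by apply/orP; left; apply/chain_edgeP; exists t; rewrite it jt; split=> //=; lia.
Qed.

Lemma edge_graph_chain n (u v : 'I_n) : (r <= n)%N ->
  edge_graph (I n) u v <-> chain_rel u v.
Proof.
move=> rn; split=> [[uv]|h].
  rewrite -mpolyXD => /(chain_idealP _ rn) /mono_idealX /edge_monoP [a [b [hab]]].
  have ab : a != b by apply: contraTneq hab => ->; rewrite (chain_rel_irr hlt).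
  rewrite le_mnm2P // !mnmDE !mnm1E !addn_gt0 !lt0b => /andP[].
  case/orP => /eqP ea /orP[] /eqP eb; move: hab ab; rewrite -ea -eb ?eqxx //.
  by rewrite chain_rel_sym.
split; first by apply: contraTneq h => ->; rewrite (chain_rel_irr hlt).
exact: chain_relP.
Qed.

Lemma has_reg2_linear_res n : (r <= n)%N -> (exists f, I n f /\ f <> 0) ->
  has_reg (I n) 2 <-> linear_res 2 (@mono_ideal k n (edge_mono (@chain_rel n))).
Proof.
move=> rn hf; have hI f := chain_idealP f rn; split=> h.
  apply: (linear_res_iff hI); apply: linear_res_of_has_reg2 h => f d If f0 hd.
  have [m hm] : exists m, m \in msupp f.
    by case: (msupp f) (msupp_eq0 f) => [|m t]; [rewrite eqxx (negbTE f0) | exists m; rewrite mem_head].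
  have /hI /(_ m hm) /edge_monoP [u [v [_ huv]]] := If.
  rewrite -(dhomog_mf hd hm) /= -(submK huv) mdegD mdegD !mdeg1.
  by rewrite leq_addl.
apply: has_reg2_of_linear_res => //.
by apply: linear_res_iff h => f; apply: iff_sym.
Qed.

End ChainIdeals.

(** * Orders with linear quotients *)

Section LinearQuotientOrders.
Variables (r s n : nat) (i j : nat -> nat).
Hypothesis hij : forall t, (t < s)%N -> (i t < j t < r)%N.
Local Notation E := (chain_edge r s i j).
Implicit Types (u v a b : nat).

Let hlt t : (t < s)%N -> (i t < j t)%N.
Proof. by move=> /hij /andP[]. Qed.

Definition smaller_edge (key : nat -> nat -> nat) K u v : bool :=
  (E n u v && (key u v < K)%N) || (E n v u && (key v u < K)%N).

Lemma smaller_edgeC key K u v : smaller_edge key K u v = smaller_edge key K v u.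
Proof. by rewrite /smaller_edge orbC. Qed.

Definition smaller_cross key u v a b : Prop :=
  let K := key u v in
  [\/ smaller_edge key K u a, smaller_edge key K u b,
      smaller_edge key K v a | smaller_edge key K v b].

Lemma smaller_edgeI t key K u v : (t < s)%N -> (i t <= u)%N ->
    (j t + u <= v + i t)%N -> (v + r <= n + j t)%N -> (key u v < K)%N ->
  smaller_edge key K u v.
Proof.
move=> h1 h2 h3 h4 h5; apply/orP; left; apply/andP; split=> //.
by apply/chain_edgeP; exists t.
Qed.

Definition long_key u v : nat := (n + u - v)%N.

(** The new edge joins [a] to [v] or [u] to [b] and is longer than [{u, v}]. As [i t0] is minimal
    and [j t0] maximal, the edge [t0] imposes only a lower bound on its length; where this fails,
    [t1] or [t2] applies. *)
Lemma long_key_cross t0 u v a b : (4 * r <= n)%N -> (t0 < s)%N ->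
    (forall t, (t < s)%N -> (i t0 <= i t)%N /\ (j t <= j t0)%N) ->
    E n u v -> E n a b -> (v < n)%N -> (b < n)%N -> [/\ a <> u, a <> v, b <> u & b <> v] ->
    (long_key a b <= long_key u v)%N ->
  smaller_cross long_key u v a b.
Proof.
move=> hn ht0 hmin Euv Eab vn bn [au av bu bv].
have uv := chain_edge_lt hlt Euv; have ab := chain_edge_lt hlt Eab.
move: Euv Eab => /chain_edgeP [t1 [ts1 i1 d1 j1]] /chain_edgeP [t2 [ts2 i2 d2 j2]].
have [m1 M1] := hmin t1 ts1; have [m2 M2] := hmin t2 ts2.
have h0 := hij ht0; have h1 := hij ts1; have h2 := hij ts2.
rewrite /long_key => hk; rewrite /smaller_cross.
have long_va : (a < u)%N -> (j t0 + a <= v + i t0)%N || (r <= a)%N || ((b < v)%N && (v + r <= n)%N) ->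
    smaller_edge long_key (long_key u v) v a.
  move=> h /orP[/orP[h'|h']|/andP[h' h'']]; rewrite smaller_edgeC.
  - by apply: (smaller_edgeI ht0); rewrite /long_key; lia.
  - by apply: (smaller_edgeI ts1); rewrite /long_key; lia.
  - by apply: (smaller_edgeI ts2); rewrite /long_key; lia.
have long_ub : (v < b)%N -> [|| (j t0 + u <= b + i t0)%N, (b + r <= n)%N | (u < a)%N && (r <= u)%N] ->
    smaller_edge long_key (long_key u v) u b.
  move=> h /or3P[h'|h'|/andP[h' h'']].
  - by apply: (smaller_edgeI ht0); rewrite /long_key; lia.
  - by apply: (smaller_edgeI ts1); rewrite /long_key; lia.
  - by apply: (smaller_edgeI ts2); rewrite /long_key; lia.
have [h|h] := ltnP a u.
  have [h'|h'] := ltnP b v; first by apply: Or43; apply: long_va; lia.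
  have [h3|h3] := leqP (j t0 + a) (v + i t0); first by apply: Or43; apply: long_va; lia.
  have [h4|h4] := leqP (j t0 + u) (b + i t0); first by apply: Or42; apply: long_ub; lia.
  have [h5|h5] := leqP r a; first by apply: Or43; apply: long_va; lia.
  by apply: Or42; apply: long_ub; lia.
by apply: Or42; apply: long_ub; lia.
Qed.

(* Pairs of vertices of the middle part [r, n - r) come first, longest first,
   then the pairs with one vertex in the middle part, then the pairs joining
   the two ends, shortest first, then the pairs inside one end, longest first. *)
Definition split_key u v : nat :=
  if (r <= u)%N && (v + r < n)%N then (n + u - v)%N
  else if (r <= u)%N && (u + r < n)%N || (r <= v)%N && (v + r < n)%N then n.+1
  else if (u < r)%N && (n <= v + r)%N then (2 * n + v - u)%N
  else (4 * n + u - v)%N.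

Lemma split_key_ends u v : (2 * r <= n)%N -> (u < r)%N -> (n <= v + r)%N -> (v < n)%N ->
  split_key u v = (2 * n + v - u)%N.
Proof.
move=> hn hu hv vn; rewrite /split_key.
case: ifP => [|_]; first lia.
case: ifP => [|_]; first lia.
by rewrite hu hv.
Qed.

Lemma split_key_end u v : (u < v < n)%N -> (2 * r <= n)%N -> (v < r)%N || (n <= u + r)%N ->
  split_key u v = (4 * n + u - v)%N.
Proof. by move=> h1 h2 h3; rewrite /split_key; do 3![case: ifP => [|_]; first lia]. Qed.

Definition end_pairs u v a b : bool := (v < r)%N && (n <= a + r)%N.

(** The edge [t0] of length 1 makes the middle part a clique, which supplies the joining edges as
    soon as [{a, b}] meets it. Only edges lying in opposite ends can remain unjoined. *)
Lemma split_key_cross t0 u v a b : (3 * r <= n)%N -> (t0 < s)%N -> j t0 = (i t0).+1 ->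
    E n u v -> E n a b -> (v < n)%N -> (b < n)%N -> [/\ a <> u, a <> v, b <> u & b <> v] ->
    (split_key a b <= split_key u v)%N ->
  [\/ smaller_cross split_key u v a b, end_pairs u v a b | end_pairs a b u v].
Proof.
move=> hn ht0 e0 Euv Eab vn bn [au av bu bv].
have uv := chain_edge_lt hlt Euv; have ab := chain_edge_lt hlt Eab.
move: Euv Eab => /chain_edgeP [t1 [ts1 i1 d1 j1]] /chain_edgeP [t2 [ts2 i2 d2 j2]].
have h0 := hij ht0; have h1 := hij ts1; have h2 := hij ts2.
pose M x := (r <= x)%N && (x + r < n)%N.
have MM x y K : M x -> M y -> (x < y)%N -> (n + x - y < K)%N -> smaller_edge split_key K x y.
  rewrite /M => /andP[hx hx'] /andP[hy hy'] xy hK; apply: (smaller_edgeI ht0); try lia.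
  by rewrite /split_key hx hy'.
have key_MO x y : M x \/ M y -> (x < y)%N -> (split_key x y <= n.+1)%N.
  rewrite /M /split_key => hxy xy; case: ifP => _; first lia.
  by case: hxy => /andP[-> ->]; rewrite ?orbT.
have key_E x y : (x < y < n)%N -> [\/ M x /\ M y /\ split_key x y = (n + x - y)%N,
    (M x \/ M y) /\ split_key x y = n.+1,
    (x < r)%N /\ (n <= y + r)%N /\ split_key x y = (2 * n + y - x)%N |
    ((y < r)%N \/ (n <= x + r)%N) /\ split_key x y = (4 * n + x - y)%N].
  move=> /andP[xy yn]; rewrite /split_key /M.
  case: ifP => [h|h]; first by apply: Or41; lia.
  case: ifP => [h'|h']; first by apply: Or42; split=> //; move/orP: h'; case; auto.
  case: ifP => [h''|h'']; first by apply: Or43; lia.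
  by apply: Or44; split=> //; lia.
have hn2 : (2 * r <= n)%N by lia.
have MM' x y K : M x -> M y -> x <> y -> (n < K)%N -> smaller_edge split_key K x y.
  move=> hx hy xy hK; have [h|h|//] := ltngtP x y; first by apply: MM => //; lia.
  by rewrite smaller_edgeC; apply: MM => //; lia.
(* When [{u, v}] joins the two ends, each middle vertex is adjacent to [u] or [v], by [t0] or by
   [t1] on a side where the gap is large enough. *)
have LRM m K : (u < r)%N -> (n <= v + r)%N -> M m -> (n.+1 < K)%N ->
    smaller_edge split_key K u m \/ smaller_edge split_key K v m.
  move=> hu hv hm hK; have [hm1 hm2] := andP hm.
  have kum : (split_key u m <= n.+1)%N by apply: key_MO; [right | lia].
  have kmv : (split_key m v <= n.+1)%N by apply: key_MO; [left | lia].
  rewrite [_ _ _ v m]smaller_edgeC.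
  have [h|h] := leqP (i t0) u; first by left; apply: (smaller_edgeI ht0); lia.
  have [h'|h'] := leqP (j t1 + u) (m + i t1); first by left; apply: (smaller_edgeI ts1); lia.
  have [h3|h3] := leqP (v + r) (n + j t0); first by right; apply: (smaller_edgeI ht0); lia.
  by right; apply: (smaller_edgeI ts1); lia.
have endM m K : (v < r)%N \/ (n <= u + r)%N -> M m -> (n.+1 < K)%N ->
    smaller_edge split_key K u m \/ smaller_edge split_key K v m.
  move=> hend hm hK; have [hm1 hm2] := andP hm; case: hend => hend; [left | right].
    have ? : (split_key u m <= n.+1)%N by apply: key_MO; [right | lia].
    by apply: (smaller_edgeI ts1); lia.
  have ? : (split_key m v <= n.+1)%N by apply: key_MO; [left | lia].
  by rewrite smaller_edgeC; apply: (smaller_edgeI ts1); lia.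
rewrite /smaller_cross => hk.
(* The four classes have disjoint, increasing ranges of keys, so [{a, b}] is never in a later class
   than [{u, v}]; ten cases remain. *)
have [[Mu [Mv kuv]]|[Muv kuv]|[hu [hv kuv]]|[hend kuv]] := key_E u v ltac:(lia);
have [[Ma [Mb kab]]|[Mab kab]|[ha [hb kab]]|[hend' kab]] := key_E a b ltac:(lia);
  rewrite kuv ?kab in hk *; try (exfalso; lia).
- apply: Or31; have [h|h] := ltnP a u.
    by apply: Or43; rewrite smaller_edgeC; apply: MM => //; lia.
  by apply: Or42; apply: MM => //; lia.
- by apply: Or31; case: Muv => hm; [apply: Or41|apply: Or43]; apply: MM' => //; lia.
- by apply: Or31; case: Muv => hm; case: Mab => hm';
    [apply: Or41|apply: Or42|apply: Or43|apply: Or44]; apply: MM' => //; lia.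
- by apply: Or31; case: (LRM a (2 * n + v - u)%N hu hv Ma ltac:(lia)) => h; [apply: Or41|apply: Or43].
- by apply: Or31; case: Mab => hm; case: (LRM _ (2 * n + v - u)%N hu hv hm ltac:(lia)) => h;
    [apply: Or41|apply: Or43|apply: Or42|apply: Or44].
- apply: Or31; have [h|h] := ltnP b v.
    by apply: Or42; apply: (smaller_edgeI ts1); rewrite ?split_key_ends; lia.
  by apply: Or43; rewrite smaller_edgeC; apply: (smaller_edgeI ts1); rewrite ?split_key_ends; lia.
- by apply: Or31; case: (endM a (4 * n + u - v)%N hend Ma ltac:(lia)) => h; [apply: Or41|apply: Or43].
- by apply: Or31; case: Mab => hm; case: (endM _ (4 * n + u - v)%N hend hm ltac:(lia)) => h;
    [apply: Or41|apply: Or43|apply: Or42|apply: Or44].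
- apply: Or31; case: hend => hend.
    have [h|h] := ltnP a u.
      by apply: Or42; apply: (smaller_edgeI ts2); rewrite ?split_key_ends; lia.
    have [h'|h'] := ltnP a v.
      by apply: Or44; apply: (smaller_edgeI ts2); rewrite ?split_key_ends; lia.
    by apply: Or41; apply: (smaller_edgeI ts1); rewrite ?split_key_end; lia.
  have [h|h] := ltnP v b.
    by apply: Or43; rewrite smaller_edgeC; apply: (smaller_edgeI ts2); rewrite ?split_key_ends; lia.
  have [h'|h'] := ltnP u b.
    by apply: Or41; rewrite smaller_edgeC; apply: (smaller_edgeI ts2); rewrite ?split_key_ends; lia.
  by apply: Or44; rewrite smaller_edgeC; apply: (smaller_edgeI ts1); rewrite ?split_key_end; lia.
rewrite /end_pairs; case: hend => hend; case: hend' => hend'; last 1 first.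
- apply: Or31; have [h|h] := ltnP a u.
    by apply: Or43; rewrite smaller_edgeC; apply: (smaller_edgeI ts1); rewrite ?split_key_end; lia.
  by apply: Or42; apply: (smaller_edgeI ts2); rewrite ?split_key_end; lia.
- apply: Or31; have [h|h] := ltnP v b.
    by apply: Or42; apply: (smaller_edgeI ts1); rewrite ?split_key_end; lia.
  by apply: Or43; rewrite smaller_edgeC; apply: (smaller_edgeI ts2); rewrite ?split_key_end; lia.
- by apply: Or32; lia.
- by apply: Or33; lia.
Qed.

Lemma chain_linear_res (k : fieldType) key :
    (forall u v a b, E n u v -> E n a b -> (v < n)%N -> (b < n)%N ->
      [/\ a <> u, a <> v, b <> u & b <> v] -> (key a b <= key u v)%N ->
      smaller_cross key u v a b) ->
  linear_res 2 (@mono_ideal k n (edge_mono (chain_rel r s i j (n := n)))).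
Proof.
move=> hkey; pose okey (u v : 'I_n) := key (minn u v) (maxn u v).
have okeyE (u v : 'I_n) : (u < v)%N -> okey u v = key u v.
  by move=> uv; rewrite /okey (minn_idPl (ltnW uv)) (maxn_idPr (ltnW uv)).
have okeyC (u v : 'I_n) : okey u v = okey v u by rewrite /okey minnC maxnC.
apply: (@linear_res_quotients k n _ okey) => //.
- exact: chain_rel_sym.
- exact: chain_rel_irr.
move=> u v a b uv ab huv hab [au av bu bv]; rewrite !okeyE // => hk.
have {}huv : E n u v.
  by case/orP: huv => // /(chain_edge_lt hlt); rewrite ltnNge (ltnW uv).
have {}hab : E n a b.
  by case/orP: hab => // /(chain_edge_lt hlt); rewrite ltnNge (ltnW ab).
have se (c w : 'I_n) : smaller_edge key (key u v) c w ->
    chain_rel r s i j c w /\ (okey c w < key u v)%N.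
  case/orP => /andP[h1 h2]; have h3 := chain_edge_lt hlt h1; rewrite /chain_rel h1 ?orbT; split=> //.
    by rewrite okeyE.
  by rewrite okeyC okeyE.
have ne (x y : 'I_n) : x != y -> nat_of_ord x <> y by move=> /eqP h /ord_inj.
case: (hkey u v a b huv hab) => //; first by split; apply: ne.
- by move=> /se [h1 h2]; exists u, a; split; auto.
- by move=> /se [h1 h2]; exists u, b; split; auto.
- by move=> /se [h1 h2]; exists v, a; split; auto.
- by move=> /se [h1 h2]; exists v, b; split; auto.
Qed.

End LinearQuotientOrders.

(** * Obstructions to linearity *)

Section InducedMatchings.
Variables (k : fieldType) (r s : nat) (i j : nat -> nat).
Hypothesis hij : forall t, (t < s)%N -> (i t < j t < r)%N.
Local Notation E := (chain_edge r s i j).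

Let hlt t : (t < s)%N -> (i t < j t)%N.
Proof. by move=> /hij /andP[]. Qed.

Definition end_matching n u v a b : Prop :=
  [/\ E n u v, E n a b, (v < r)%N, (n <= a + r)%N /\ (b < n)%N &
    ~~ [|| E n u a, E n u b, E n v a | E n v b]].

Lemma chain_edge_move m n x y x' y' :
    (forall t, (t < s)%N -> (i t <= x)%N -> (j t + x <= y + i t)%N -> (y + r <= m + j t)%N ->
      [/\ i t <= x', j t + x' <= y' + i t & y' + r <= n + j t]%N) ->
  E m x y -> E n x' y'.
Proof.
move=> h /chain_edgeP [t [h1 h2 h3 h4]]; apply/chain_edgeP; exists t.
by have [] := h t h1 h2 h3 h4.
Qed.

(** Adjacency inside an end depends only on positions relative to that end. Between the ends the gap
    condition holds automatically once there are [3 * r] vertices. *)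
Lemma end_matching_shift m n u v a b : (3 * r <= m)%N -> (3 * r <= n)%N ->
  end_matching m u v a b -> end_matching n u v (a + n - m) (b + n - m).
Proof.
move=> hm hn [h1 h2 h3 [h4 h5] h6].
have uv := chain_edge_lt hlt h1; have ab := chain_edge_lt hlt h2.
split=> //.
- by apply: chain_edge_move h1 => t /hij ? ? ? ?; split; lia.
- by apply: chain_edge_move h2 => t /hij ? ? ? ?; split; lia.
- by split; lia.
- by apply: contra h6 => /or4P[] h; apply/or4P;
    [apply: Or41|apply: Or42|apply: Or43|apply: Or44]; apply: chain_edge_move h => t /hij ? ? ? ?; split; lia.
Qed.

Section Fixed.
Variable n : nat.
Hypothesis hn : (3 * r <= n)%N.
Local Notation e := (chain_rel r s i j (n := n)).
Local Notation lin := (linear_res 2 (@mono_ideal k n (edge_mono e))).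

(** Two edges in opposite ends are now joined by some edge, and edges between the ends have smaller
    keys than edges inside one end. *)
Lemma linear_res_no_end_matching t0 : (t0 < s)%N -> j t0 = (i t0).+1 ->
  (forall u v a b, ~ end_matching n u v a b) -> lin.
Proof.
move=> ht0 e0 hno; apply: (chain_linear_res hij k (key := split_key r n)).
move=> u v a b Euv Eab vn bn hd hk.
have uv := chain_edge_lt hlt Euv; have ab := chain_edge_lt hlt Eab.
case: (split_key_cross hij hn ht0 e0 Euv Eab vn bn hd hk) => // /andP[h1 h2].
  have [h|h] := boolP [|| E n u a, E n u b, E n v a | E n v b]; last by case: (hno u v a b).
  rewrite /smaller_cross /smaller_edge (@split_key_end r n u v) ?uv //; try lia.
  by case/or4P: h => h; [apply: Or41|apply: Or42|apply: Or43|apply: Or44];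
    apply/orP; left; rewrite h split_key_ends //=; lia.
have [h|h] := boolP [|| E n a u, E n a v, E n b u | E n b v]; last by case: (hno a b u v).
rewrite /smaller_cross /smaller_edge (@split_key_end r n u v) ?uv //; try lia.
by case/or4P: h => h; [apply: Or41|apply: Or43|apply: Or42|apply: Or44];
  apply/orP; right; rewrite h split_key_ends //=; lia.
Qed.

(** After ordering the two edges by key, [split_key_cross] leaves only opposite ends, since its
    first outcome contradicts inducedness. *)
Lemma end_matching_of_cross t0 (u v a b : 'I_n) : (t0 < s)%N -> j t0 = (i t0).+1 ->
    e u v -> e a b -> ~~ [|| e u a, e u b, e v a | e v b] ->
  exists u v a b, end_matching n u v a b.
Proof.
move=> ht0 e0.
wlog huv : u v / E n u v => [hw euv|].
  case/orP: (euv) => huv; first exact: hw.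
  move=> eab h; apply: (hw v u) => //; first by rewrite chain_rel_sym.
  by apply: contra h => /or4P[] ->; rewrite ?orbT.
wlog hab : a b / E n a b => [hw euv eab|_ _].
  case/orP: (eab) => hab; first exact: hw.
  move=> h; apply: (hw b a) => //; first by rewrite chain_rel_sym.
  by apply: contra h => /or4P[] ->; rewrite ?orbT.
wlog hk : u v a b huv hab / (split_key r n a b <= split_key r n u v)%N => [hw h|].
  have [hk|hk] := leqP (split_key r n a b) (split_key r n u v); first exact: (hw u v a b).
  apply: (hw a b u v) => //; first exact: ltnW.
  by apply: contra h => /or4P[]; rewrite chain_rel_sym => ->; rewrite ?orbT.
move=> hno.
have E_e (x y : 'I_n) : E n x y -> e x y by rewrite /chain_rel => ->.
have hd : [/\ nat_of_ord a <> u, nat_of_ord a <> v, nat_of_ord b <> u & nat_of_ord b <> v].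
  split=> /ord_inj h; move: hno huv hab; rewrite h => /negP hno h1 h2; apply: hno.
  - by rewrite (E_e _ _ h2) orbT.
  - by rewrite (E_e _ _ h2) !orbT.
  - by rewrite [chain_rel _ _ _ _ u a]chain_rel_sym (E_e _ _ h2).
  - by rewrite (E_e _ _ h1) orbT.
have se key K (x y : 'I_n) : smaller_edge r s n i j key K x y -> e x y.
  by rewrite /smaller_edge /chain_rel => /orP[] /andP[-> _]; rewrite ?orbT.
have eE (x y : 'I_n) : ~~ e x y -> E n x y = false /\ E n y x = false.
  by rewrite negb_or => /andP[/negbTE -> /negbTE ->].
have [hua hub hva hvb] : [/\ ~~ e u a, ~~ e u b, ~~ e v a & ~~ e v b].
  by move: hno; rewrite !negb_or => /and4P[].
have [f1 f2] := eE _ _ hua; have [f3 f4] := eE _ _ hub.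
have [f5 f6] := eE _ _ hva; have [f7 f8] := eE _ _ hvb.
case: (split_key_cross hij hn ht0 e0 huv hab (ltn_ord v) (ltn_ord b) hd hk).
- by case=> /se h; exfalso; move: h; apply/negP.
- by move=> /andP[h1 h2]; exists u, v, a, b; split; rewrite ?f1 ?f3 ?f5 ?f7.
- by move=> /andP[h1 h2]; exists a, b, u, v; split; rewrite ?f2 ?f4 ?f6 ?f8.
Qed.

Lemma cross_of_end_matching u v a b : end_matching n u v a b ->
  exists u' v' a' b' : 'I_n, [/\ (u' < v')%N, (v' < a')%N, (a' < b')%N, e u' v' /\ e a' b' &
    ~~ [|| e u' a', e u' b', e v' a' | e v' b']].
Proof.
move=> [h1 h2 h3 [h4 h5] h6].
have uv := chain_edge_lt hlt h1; have ab := chain_edge_lt hlt h2.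
have vn : (v < n)%N by lia.
have un : (u < n)%N by lia.
have an : (a < n)%N by lia.
exists (Ordinal un), (Ordinal vn), (Ordinal an), (Ordinal h5); split=> //=.
- lia.
- by rewrite /chain_rel /= h1 h2.
apply: contra h6; rewrite /chain_rel /= => /or4P[] /orP[h|h]; rewrite ?h ?orbT //;
  by have := chain_edge_lt hlt h; lia.
Qed.

(** The complement on these vertices is a 4-cycle. The indicator of one of its sides is a cocycle,
    as there are no triangles, but its sum around the cycle is 1. *)
Lemma nonlinear_of_end_matching u v a b : end_matching n u v a b -> ~ lin.
Proof.
move=> /cross_of_end_matching [{}u [{}v [{}a [{}b [uv va ab [euv eab] hno]]]]] hlin.
pose W : {set 'I_n} := [set x in [:: u; v; a; b]].
pose c (x y : 'I_n) : k := ((x == u) && (y == a))%:R.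
have irr := chain_rel_irr r (n := n) hlt; have sym := @chain_rel_sym r s i j n.
have [hua hub hva hvb] : [/\ ~~ e u a, ~~ e u b, ~~ e v a & ~~ e v b].
  by move: hno; rewrite !negb_or => /and4P[].
have [uW vW aW bW] : [/\ u \in W, v \in W, a \in W & b \in W].
  by rewrite !inE !eqxx !orbT.
have [|f hf] := @linear_res_coboundary k n e W c sym irr _ hlin.
  have F (x y : 'I_n) : (x < y)%N -> (y < x)%N = false by move=> h; rewrite ltnNge ltnW.
  have ua := ltn_trans uv va; have vb := ltn_trans va ab; have ub := ltn_trans uv vb.
  have F1 := (F _ _ uv, F _ _ ua, F _ _ ub, F _ _ va, F _ _ vb, F _ _ ab).
  (* Every non-edge goes from [{u, v}] to [{a, b}], so no three vertices are pairwise
     nonadjacent. *)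
  have hxy (x y : 'I_n) : x \in W -> y \in W -> (x < y)%N -> ~~ e x y -> (x <= v)%N && (a <= y)%N.
    rewrite !inE => /or4P[] /eqP -> /or4P[] /eqP ->; rewrite ?ltnn ?F1 ?euv ?eab //;
    by rewrite ?leqnn ?(ltnW uv) ?(ltnW ab).
  move=> x y z /andP[xy yz] [xW yW zW] [exy eyz _].
  have [[_ h1] [h2 _]] := (andP (hxy x y xW yW xy exy), andP (hxy y z yW zW yz eyz)).
  by have := leq_trans h1 h2; rewrite leqNgt va.
have := hf u a uW aW (ltn_trans uv va) hua.
have := hf u b uW bW (ltn_trans (ltn_trans uv va) ab) hub.
have := hf v a vW aW va hva.
have := hf v b vW bW (ltn_trans va ab) hvb.
have nvu : v == u = false by rewrite -val_eqE gtn_eqF.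
have nba : b == a = false by rewrite -val_eqE gtn_eqF.
rewrite /c !eqxx nvu nba /= => /eqP; rewrite eq_sym subr_eq0 => /eqP ->.
move=> /eqP; rewrite eq_sym subr_eq0 => /eqP <-.
move=> /eqP; rewrite eq_sym subr_eq0 => /eqP <-.
by rewrite subrr => /eqP; rewrite oner_eq0.
Qed.

End Fixed.

Section InducedMatchingNumber.
Variables (n : nat) (G : 'I_n -> 'I_n -> Prop) (e : rel 'I_n).
Hypotheses (hG : forall u v, G u v <-> e u v).
Hypotheses (e_sym : ssrbool.symmetric e) (e_irr : irreflexive e).

Lemma induced_2K2P : (exists u v a b, [/\ e u v, e a b & ~~ [|| e u a, e u b, e v a | e v b]]) <->
  exists2 h, (1 < h)%N & has_induced_gK2 G h.
Proof.
split=> [[u [v [a [b [euv eab hno]]]]]|[h hh [phi [_ hphi]]]].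
  have [hua hub hva hvb] : [/\ ~~ e u a, ~~ e u b, ~~ e v a & ~~ e v b].
    by move: hno; rewrite !negb_or => /and4P[].
  pose phi (x : 'I_2 * bool) := if x.1 == ord0 then (if x.2 then v else u) else (if x.2 then b else a).
  have hphi x y : G (phi x) (phi y) <-> gK2 x y.
    rewrite hG /phi /gK2; case: x y => [[[|[|//]] hx] bx] [[[|[|//]] hy] by'] /=; rewrite -?val_eqE /=;
    by case: bx; case: by' => /=; rewrite ?e_irr ?euv ?eab ?[e v u]e_sym ?[e b a]e_sym
      ?[e a u]e_sym ?[e b u]e_sym ?[e a v]e_sym ?[e b v]e_sym ?euv ?eab
      ?(negbTE hua) ?(negbTE hub) ?(negbTE hva) ?(negbTE hvb).
  (* Injectivity: if [phi x = phi y], the partner of [x] is also the partner of [y], and partners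
     are unique. *)
  exists 2 => //; exists phi; split=> // x y exy.
  have : gK2 (x.1, ~~ x.2) y by apply/hphi; rewrite -exy; apply/hphi; rewrite /gK2 /= eqxx; case: x.2.
  case/andP => /= /eqP h1 h2; apply/eqP; rewrite -pair_eqE /= h1 eqxx /=.
  by move: h2; case: x.2; case: y.2.
have h0 := ltnW hh.
pose p0 := Ordinal h0; pose p1 := Ordinal hh.
exists (phi (p0, false)), (phi (p0, true)), (phi (p1, false)), (phi (p1, true)).
split; first by apply/hG/hphi.
  by apply/hG/hphi.
by apply/negP => /or4P[] /hG /hphi.
Qed.

Lemma is_indmatch1P : (exists u v, e u v) -> is_indmatch G 1 <->
  ~ exists u v a b, [/\ e u v, e a b & ~~ [|| e u a, e u b, e v a | e v b]].
Proof.
move=> [u [v euv]]; split=> [[_ h] /induced_2K2P [g hg /h]|h]; first by rewrite leqNgt hg.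
split=> [|g hg]; last first.
  by rewrite leqNgt; apply/negP => h1; apply: h; apply/induced_2K2P; exists g.
pose phi (x : 'I_1 * bool) := if x.2 then v else u.
have uv : u != v by apply: contraTneq euv => ->; rewrite e_irr.
exists phi; split=> [[x1 x2] [y1 y2]|[x1 x2] [y1 y2]]; rewrite /phi /gK2 !ord1 /=.
  by case: x2; case: y2 => // h'; move: uv; rewrite h' eqxx.
by rewrite hG; case: x2; case: y2; rewrite /= ?e_irr ?euv // e_sym euv.
Qed.

End InducedMatchingNumber.

End InducedMatchings.

Section NoConsecutiveEdges.
Variables (k : fieldType) (r s n : nat) (i j : nat -> nat).
Hypothesis hij : forall t, (t < s)%N -> (i t < j t < r)%N.

Let hlt t : (t < s)%N -> (i t < j t)%N.
Proof. by move=> /hij /andP[]. Qed.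

(** On the vertices from [i t0] to [last], a potential for the indicator of long non-edges would be
    constant along consecutive vertices, yet differ by 1 between the two extremes. *)
Lemma nonlinear_no_consecutive t0 t1 : (5 * r <= n)%N -> (t0 < s)%N -> (t1 < s)%N ->
    (forall t, (t < s)%N -> (i t0 <= i t)%N /\ (j t <= j t1)%N) ->
    (forall t, (t < s)%N -> i t = i t0 -> (j t <= j t0)%N) -> (j t0 < j t1)%N ->
    (forall t, (t < s)%N -> j t <> (i t).+1) ->
  ~ linear_res 2 (@mono_ideal k n (edge_mono (chain_rel r s i j (n := n)))).
Proof.
move=> hn ts0 ts1 hmin hmax j01 hd hlin.
set e := chain_rel r s i j (n := n).
have h0 := hij ts0; have h1 := hij ts1.
pose last := (n + j t1 - r)%N.
have lastn : (last < n)%N by rewrite /last; lia.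
have firstn : (i t0 < n)%N by lia.
pose W := [set x : 'I_n | (i t0 <= x)%N && (x <= last)%N].
have inW (x : 'I_n) : x \in W = (i t0 <= x <= last)%N by rewrite inE.
(* Non-edges are either shorter than [r] or join the two ends. *)
have short u v : (i t0 <= u)%N -> (v <= last)%N -> (u < v)%N ->
    ~~ chain_edge r s i j n u v ->
    (v < u + r)%N \/ ((u < r)%N /\ (n <= v + r)%N).
  move=> hu hv uv /chain_edgeP huv.
  have [h|h] := ltnP v (u + r); first by left.
  right; have [h2|h2] := leqP (v + r) (n + j t0).
    by case: huv; exists t0; split=> //; lia.
  have [h3|h3] := leqP (i t1) u.
    by case: huv; exists t1; split=> //; rewrite /last in hv; lia.
  by split; lia.
(* Two short gaps add up to less than [2 * r], while a gap between the ends exceeds it and cannot be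
   followed by another. *)
pose c (x y : 'I_n) : k := (2 * r <= y - x)%N%:R.
have neE (x y : 'I_n) : ~~ e x y -> ~~ chain_edge r s i j n x y.
  by rewrite negb_or => /andP[].
have [|f hf] := @linear_res_coboundary k n e W c (@chain_rel_sym r s i j n) (chain_rel_irr r (n := n) hlt) _ hlin.
  move=> u v w /andP[uv vw]; rewrite !inW => -[/andP[u1 _] /andP[v1 v2] /andP[_ w2]].
  move=> [/neE huv /neE hvw /neE huw].
  have Huv := short u v u1 v2 uv huv; have Hvw := short v w v1 w2 vw hvw.
  have Huw := short u w u1 w2 (ltn_trans uv vw) huw.
  rewrite /c -natrD; congr _%:R.
  clear -Huv Hvw Huw uv vw hn.
  by do 3![case: leqP => ? /=]; lia.
pose first := Ordinal firstn.
have fconst x (hx : (x < n)%N) : (i t0 <= x <= last)%N -> f (Ordinal hx) = f first.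
  elim: x hx => [|x IH] hx hW.
    by congr f; apply: val_inj; rewrite /=; lia.
  have [hx0|hx0] := eqVneq x.+1 (i t0); first by congr f; apply: val_inj.
  have hx' := ltnW hx.
  have hW' : (i t0 <= x <= last)%N by lia.
  rewrite -(IH hx' hW'); apply/eqP; rewrite -subr_eq0 -hf ?inW //=.
    by rewrite /c /= subSnn; case: leqP => //; lia.
  apply/negP => /orP[] /chain_edgeP [t [ts g1 g2 _]]; have := hd t ts; have := hij ts.
    by rewrite /= in g2; lia.
  by rewrite /= in g2; lia.
have first_last : (i t0 <= last)%N by rewrite /last; lia.
have hfl : f (Ordinal lastn) = f first by apply: fconst; rewrite first_last leqnn.
(* The extremes are not adjacent: such an edge would need [i t = i t0], hence [j t <= j t0 < j t1],
   and could not reach [last]. *)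
have : c first (Ordinal lastn) = 0.
  rewrite (hf first (Ordinal lastn)) ?inW ?leqnn ?first_last //=; first by rewrite hfl subrr.
    by rewrite /last; lia.
  apply/negP => /orP[] /chain_edgeP [t [ts /= g1 g2 g3]]; have [m1 m2] := hmin t ts.
    have := hmax t ts; rewrite /last in g3; lia.
  by have := hij ts; rewrite /last in g1 g2 g3; lia.
rewrite /c /= (_ : (2 * r <= last - i t0)%N = true); first by move/eqP; rewrite oner_eq0.
by rewrite /last; lia.
Qed.

End NoConsecutiveEdges.

(** * Lexicographic enumerations and finite minima *)

Section LexEdgeEnumerations.
Variables (s : nat) (i j : nat -> nat).
Hypothesis i_le : forall t, (t.+1 < s)%N -> (i t <= i t.+1)%N.
Hypothesis j_lt : forall t, (t.+1 < s)%N -> i t = i t.+1 -> (j t < j t.+1)%N.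

Lemma lex_enum_i_le t u : (t <= u)%N -> (u < s)%N -> (i t <= i u)%N.
Proof.
move=> /subnKC <-; elim: (u - t)%N => [|c IH]; rewrite ?addn0 // addnS => h.
by apply: leq_trans (IH (ltnW h)) (i_le h).
Qed.

Lemma lex_enum_j_le t u : (t <= u)%N -> (u < s)%N -> i t = i u -> (j t <= j u)%N.
Proof.
move=> /subnKC <-; elim: (u - t)%N => [|c IH]; rewrite ?addn0 // addnS => h e.
have h1 := lex_enum_i_le (leq_addr c t) (ltnW h).
have h2 := i_le h.
have ec : i t = i (t + c)%N by lia.
apply: leq_trans (IH (ltnW h) ec) _; apply: ltnW; apply: (j_lt h); lia.
Qed.

End LexEdgeEnumerations.

Lemma bigminn_le (I : eqType) (l : seq I) (m : nat) (F : I -> nat) x :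
  x \in l -> (\big[minn/m]_(t <- l) F t <= F x)%N.
Proof.
elim: l => // y l IH; rewrite inE big_cons => /orP[/eqP ->|/IH h]; first exact: geq_minl.
exact: leq_trans (geq_minr _ _) h.
Qed.

Lemma bigminn_eq (I : eqType) (l : seq I) (m : nat) (F : I -> nat) :
  \big[minn/m]_(t <- l) F t = m \/ exists x, \big[minn/m]_(t <- l) F t = F x.
Proof.
elim: l => [|y l IH]; first by rewrite big_nil; left.
rewrite big_cons /minn; case: ifP => _; [by right; exists y | exact: IH].
Qed.

Local Close Scope ring_scope.

Theorem theorem1p3 (k : fieldType) (I : forall n : nat, {mpoly k[n]} -> Prop)
    (hchain : Inc_invariant_chain I)
    (hedge : forall n : nat, (1 <= n)%N -> is_edge_ideal (I n))
    (hnonzero : eventually_nonzero I)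
    (r : nat) (hr : is_stability_index I r)
    (s : nat) (i j : nat -> nat)
    (hE : lex_edge_enum (edge_graph (I r)) s i j)
    (q : nat) (hq : q = (\max_(t < s | i t == i 0) t)%N) :
  (exists N : nat, forall n : nat, (N <= n)%N -> has_reg (I n) 2)
  <->
  (j q = (\max_(t < s) j t)%N
   \/ (((\big[minn/r]_(t < s) (j t - i t))%N = 1%N)
       /\ is_indmatch (edge_graph (I (3 * r)%N)) 1)).
Proof.
have [r_gt0 hstab _] := hr.
have [hij hG i_le j_lt] := hE.
have hlt t : (t < s)%N -> (i t < j t)%N by move=> /hij /andP[].
have [N0 hN0] := hnonzero.
have rel3 (u v : 'I_(3 * r)) : edge_graph (I (3 * r)%N) u v <-> chain_rel r s i j u v.
  by apply: (edge_graph_chain hchain r_gt0 (hedge r r_gt0) hstab hE); lia.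
have reg_lin n : (maxn r N0 <= n)%N ->
    has_reg (I n) 2 <-> linear_res 2 (@mono_ideal k n (edge_mono (chain_rel r s i j (n := n)))).
  rewrite geq_max => /andP[rn Nn].
  exact: (has_reg2_linear_res hchain r_gt0 (hedge r r_gt0) hstab hE rn (hN0 n Nn)).
(* Without edges in [G_r], all later ideals would vanish. *)
have s_gt0 : (0 < s)%N.
  rewrite lt0n; apply/eqP => s0.
  have [f [If f0]] := hN0 (maxn r N0) (leq_maxr _ _).
  apply: f0; apply/(mono_ideal0 f).
  move: If => /(chain_idealP hchain r_gt0 (hedge r r_gt0) hstab hE f (leq_maxl r N0)) h m /h.
  by move=> /edge_monoP [u [v [/orP[] /chain_edgeP [t []]]]]; rewrite s0.
(* [q] is the last position with the smallest [i]; by the lexicographic order its [j] is the largest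
   among those positions. *)
have [q_lt iq q_max] : [/\ (q < s)%N, i q = i 0%N &
    forall t, (t < s)%N -> i t = i 0%N -> (j t <= j q)%N].
  have h0 : (0 < #|[pred t : 'I_s | i t == i 0%N]|)%N.
    by apply/card_gt0P; exists (Ordinal s_gt0); rewrite inE.
  have [t ht et] := eq_bigmax_cond (fun t : 'I_s => nat_of_ord t) h0.
  have eq : q = t by rewrite hq -et.
  split; rewrite ?eq //; first by apply/eqP.
  move=> u us eu; rewrite -eq.
  have uq : (u <= q)%N.
    rewrite hq; apply: (@leq_bigmax_cond _ (fun t : 'I_s => i t == i 0%N)
      (fun t : 'I_s => nat_of_ord t) (Ordinal us)).
    by rewrite /= eu.
  apply: (lex_enum_j_le i_le j_lt uq); rewrite eq //.
  by rewrite eu; apply/esym/eqP.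
have i_min t : (t < s)%N -> (i 0%N <= i t)%N by move=> ts; apply: (lex_enum_i_le i_le).
have [t1 jt1] : exists t1 : 'I_s, (\max_(t < s) j t)%N = j t1.
  by have [|t1 ht1] := eq_bigmax (fun t : 'I_s => j t); [rewrite card_ord | exists t1].
have j_max t : (t < s)%N -> (j t <= j t1)%N.
  by move=> ts; rewrite -jt1; apply: (leq_bigmax (Ordinal ts)).
(* The default value [r] of the minimum is never reached, since [j t - i t < r] and [s] is
   positive. *)
have min1P : (\big[minn/r]_(t < s) (j t - i t))%N = 1%N <->
    exists2 t, (t < s)%N & j t = (i t).+1.
  pose F (t : 'I_s) := j t - i t; pose B := \big[minn/r]_(t <- index_enum 'I_s) F t.
  have hB : B = r \/ exists t, B = F t by exact: bigminn_eq.
  have leB t : B <= F t by apply: bigminn_le; apply: mem_index_enum.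
  rewrite -[X in X = 1 <-> _]/B; clearbody B; split=> [h|[t ts jt]].
    case: hB => [e|[t e]]; first by have := hij 0 s_gt0; lia.
    by exists t => //; rewrite /F in e; have := hij t (ltn_ord t); lia.
  have := leB (Ordinal ts); rewrite /F /= => le1; have hr1 := hij t ts.
  case: hB => [e|[t' e]]; first lia.
  by have := hij t' (ltn_ord t'); rewrite /F in e; lia.
have ex_edge : exists u v : 'I_(3 * r), chain_rel r s i j u v.
  have h := hij 0%N s_gt0.
  have un : (i 0 < 3 * r)%N by lia.
  have vn : (j 0 < 3 * r)%N by lia.
  exists (Ordinal un), (Ordinal vn); apply/orP; left; apply/chain_edgeP.
  by exists 0%N; split=> //=; lia.
have indP := is_indmatch1P rel3 (@chain_rel_sym r s i j _) (chain_rel_irr r (n := 3 * r) hlt) ex_edge.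
rewrite jt1 min1P indP; split.
- move=> [N hN]; have [->|jq] := eqVneq (j q) (j t1); [by left | right].
  have jq1 : (j q < j t1)%N by rewrite ltn_neqAle jq j_max.
  pose n := (maxn (5 * r) (maxn N (maxn r N0)))%N.
  have [n1 n2 n3] : [/\ 5 * r <= n, N <= n & maxn r N0 <= n]%N by rewrite /n; split; lia.
  have hlin := (reg_lin n n3).1 (hN n n2).
  (* Otherwise the cocycle of long non-edges contradicts linearity. *)
  have [t0 ts0 e0] : exists2 t, (t < s)%N & j t = (i t).+1.
    have [/hasP [t]|/hasPn hd] := boolP (has (fun t => j t == (i t).+1) (iota 0 s)).
      by rewrite mem_iota => ts /eqP; exists t.
    have n5 : (5 * r <= n)%N by lia.
    case: (nonlinear_no_consecutive hij n5 q_lt (ltn_ord t1) _ _ jq1 _ hlin) => t ts.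
    - by rewrite iq; split; [apply: i_min | apply: j_max].
    - by rewrite iq; apply: q_max.
    - by apply/eqP; apply: hd; rewrite mem_iota.
  split; first by exists t0.
  move=> [u [v [a [b [huv hab hno]]]]].
  (* An induced [2K_2] of [G_{3r}] is moved to the two ends and then transported to [G_n]. *)
  have [u' [v' [a' [b' hend]]]] := end_matching_of_cross hij (leqnn _) ts0 e0 huv hab hno.
  have n4 : (3 * r <= n)%N by lia.
  exact: (nonlinear_of_end_matching hij n4 (end_matching_shift hij (leqnn _) n4 hend) hlin).
move=> h; exists (maxn (4 * r) (maxn r N0)) => n; rewrite geq_max => /andP[n4 n3].
apply/(reg_lin n n3).
case: h => [jq|[[t0 ts0 e0] hno]].
  (* Here the edge [q] has both the smallest [i] and the largest [j], as [long_key_cross]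
     requires. *)
  apply: (chain_linear_res hij k (key := long_key n)).
  move=> u v a b huv hab vn bn hd hk.
  apply: (long_key_cross hij n4 q_lt _ huv hab vn bn hd hk) => t ts.
  by rewrite iq jq; split; [apply: i_min | apply: j_max].
have n5 : (3 * r <= n)%N by lia.
(* A matching at the ends of [G_n] would be carried back to [G_{3r}]. *)
apply: (linear_res_no_end_matching k hij n5 ts0 e0) => u v a b hend.
apply: hno.
have [u' [v' [a' [b' [_ _ _ [huv hab] hc]]]]] :=
  cross_of_end_matching hij (leqnn _) (end_matching_shift hij n5 (leqnn _) hend).
by exists u', v', a', b'.
Qed.
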